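(* Let $n\ge 3$ be an odd integer and let $m=\phi(n)/2$, where $\phi$ is Euler's totient function. Let $S_n=\{a\in\mathbb{Z} : 1\le a<n/2,\ \gcd(a,n)=1\}$ and let $$D_n=\left(\sec\left(\frac{2jk\pi}{n}\right)\right)_{j,k\in S_n}.$$ Then $$\det(D_n)=\varepsilon(n)\,(-1)^{\frac{(n-1)m}{2}}\left(\frac{2n}{\pi}\right)^m\prod_{\chi_n\ \text{even}}\chi_n(4)\,L(1,\chi_n\psi),$$ where the product runs over all even Dirichlet characters $\chi_n$ modulo $n$, $\psi$ is the unique primitive Dirichlet character modulo $4$ (so $\psi(k)=\left(\frac{-1}{k}\right)$ for odd $k$), and $\varepsilon(n)\in\{1,-1\}$ is the sign defined in the context.
   Context: Rows and columns of $D_n$ are indexed by $S_n$ in the same order. A Dirichlet character $\chi$ is even if $\chi(-1)=1$. The principal character modulo $n$ is included among the even characters. The product $\chi_n\psi$ is regarded as a Dirichlet character modulo $4n$ (not replaced by the primitive character inducing it), and $L(s,\chi)$ denotes the Dirichlet $L$-function of $\chi$. Definition of $\varepsilon(n)$: write $n=\prod_{i=1}^r p_i^{e_i}$ with $p_1,\dots,p_r$ distinct odd primes and $e_i\ge 1$. Then $$\varepsilon(n)=\begin{cases}-1 & \text{if } r=1 \text{ and } p_1\equiv 1 \text{ or } p_1\equiv 4e_1+3 \pmod 8,\\ -1 & \text{if } r=2 \text{ and } p_1+p_2\equiv 0\pmod 4,\\ 1 & \text{otherwise.}\end{cases}$$ *)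

(* Defs.v *)
From HB Require Import structures.
From mathcomp Require Import all_boot all_order all_algebra.
From mathcomp Require Import all_classical all_reals all_analysis.
From mathcomp Require Import complex.

Set Implicit Arguments.
Unset Strict Implicit.
Unset Printing Implicit Defensive.

Import Order.TTheory GRing.Theory Num.Theory.
Import numFieldNormedType.Exports.

Local Open Scope classical_set_scope.
Local Open Scope ring_scope.
Local Open Scope complex_scope.

(* chi 1 = 1 is implied: chi 1 is idempotent, and nonzero by the last clause. *)
Definition dirichlet_char (R : realType) (n : nat) (chi : int -> R[i]) : Prop :=
  [/\ forall a, chi (a + n%:Z) = chi a,
      forall a b, chi (a * b) = chi a * chi b
    & forall a, (chi a != 0) = coprimez a n%:Z].

Definition even_char (R : realType) (chi : int -> R[i]) : Prop := chi (-1) = 1.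

(* Finite for n > 0, since chi is determined by n values, each 0 or a root of
   unity of bounded order; so \big[*%R/1] over it is a genuine product
   (on an infinite support that notation would denote the neutral element). *)
Definition even_chars (R : realType) (n : nat) : set (int -> R[i]) :=
  [set chi | dirichlet_char n chi /\ even_char chi].

Definition induced_modulus (R : realType) (n : nat) (chi : int -> R[i])
    (d : nat) : Prop :=
  (d %| n)%N /\
  forall a, coprimez a n%:Z -> (a = 1 %[mod d%:Z])%Z -> chi a = 1.

Definition primitive_char (R : realType) (n : nat) (chi : int -> R[i]) : Prop :=
  dirichlet_char n chi /\ forall d, (d < n)%N -> ~ induced_modulus n chi d.

(* k ^ s = k ^ (Re s) * e ^ (i (Im s) ln k), for k >= 1. *)
Definition cpow_nat (R : realType) (k : nat) (s : R[i]) : R[i] :=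
  (k%:R `^ complex.Re s)%:C *
  (cos (complex.Im s * ln k%:R) +i* sin (complex.Im s * ln k%:R)).

(* Sum of the Dirichlet series, as the limit of its partial sums in the order
   of increasing k. For a non-principal character the series converges for
   Re s > 0, only conditionally when Re s <= 1, and its sum there is the value
   of the analytically continued L-function. Elsewhere the limit need not
   exist, and the value is then meaningless. The regular module R[i]^o carries
   the topology of the norm of R[i]. *)
Definition dirichletL (R : realType) (s : R[i]) (chi : int -> R[i]) : R[i] :=
  lim ((fun N => \sum_(1 <= k < N.+1) chi k%:Z / cpow_nat k s
        : R[i]^o) @ \oo).

Definition sec (R : realType) (x : R) : R := (cos x)^-1.

Definition Sset (n : nat) : {set 'I_n} :=
  [set a : 'I_n | [&& 1 <= a, 2 * a < n & coprime a n]%N].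

Definition Dmat (R : realType) (n : nat) : 'M[R]_#|Sset n| :=
  \matrix_(u, v)
    let j : 'I_n := enum_val u in
    let k : 'I_n := enum_val v in
    sec ((2 * j * k)%N%:R * pi / n%:R).

Definition eps_sign (n : nat) : int :=
  match prime_decomp n with
  | [:: (p, e)] =>
      if (p == 1 %[mod 8]) || (p == 4 * e + 3 %[mod 8]) then -1 else 1
  | [:: (p, _); (q, _)] => if (4 %| p + q)%N then -1 else 1
  | _ => 1
  end.

Definition chi4 (R : realType) (k : int) : R[i] :=
  if (k %% 4)%Z == 1 then 1 else if (k %% 4)%Z == 3 then -1 else 0.

Lemma modz4_cases (a : int) :
  [|| (a %% 4)%Z == 0, (a %% 4)%Z == 1, (a %% 4)%Z == 2 | (a %% 4)%Z == 3].
Proof.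
have := modz_ge0 a (isT : (4 : int) != 0).
have := ltz_pmod a (isT : (0 : int) < 4).
by case: (a %% 4)%Z => [[|[|[|[|r]]]]|r].
Qed.

Lemma coprimez4 (a : int) :
  coprimez a 4 = ((a %% 4)%Z == 1) || ((a %% 4)%Z == 3).
Proof.
by rewrite /coprimez -gcdz_modl; case/or4P: (modz4_cases a) => /eqP ->.
Qed.

Lemma primitive_chi4 (R : realType) : primitive_char 4 (@chi4 R).
Proof.
split; first split.
- by move=> a; rewrite /chi4 modzDr.
- move=> a b; rewrite /chi4 -modzMml -modzMmr.
  by case/or4P: (modz4_cases a) => /eqP ->; case/or4P: (modz4_cases b) => /eqP ->;
    rewrite /= ?mulr0 ?mul0r ?mulr1 ?mul1r ?mulrNN ?mulr1.
- move=> a; rewrite coprimez4 /chi4.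
  by case/or4P: (modz4_cases a) => /eqP ->; rewrite /= ?oppr_eq0 ?oner_eq0 ?eqxx.
case=> [|[|[|[|d]]]] // _ [] // _ h.
- have /eqP := h 3 isT (erefl _).
  by rewrite /chi4 /= eqNr oner_eq0.
- have /eqP := h 3 isT (erefl _).
  by rewrite /chi4 /= eqNr oner_eq0.
Qed.

Lemma primitive_char4_unique (R : realType) (psi : int -> R[i]) :
  primitive_char 4 psi -> psi = @chi4 R.
Proof.
move=> [[per mul nz] prim].
have perM (q : nat) a : psi (a + q%:Z * 4) = psi a.
  elim: q => [|q IH]; first by rewrite mul0r addr0.
  by rewrite intS mulrDl mul1r addrCA addrC per.
have pmod a : psi a = psi (a %% 4)%Z.
  rewrite {1}(divz_eq a 4) addrC; case: (a %/ 4)%Z => q; first exact: perM.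
  by rewrite NegzE -[LHS](perM q.+1) mulNr subrK.
have p1 : psi 1 = 1.
  have h : psi 1 != 0 by rewrite nz.
  by apply: (mulfI h); rewrite -mul !mulr1.
have p3 : psi 3 = -1.
  have : psi 3 * psi 3 = 1 by rewrite -mul pmod -p1.
  move/eqP; rewrite -expr2 sqrf_eq1 => /orP[/eqP p3|/eqP //].
  case: (prim 1%N isT); split=> // a; rewrite coprimez4 pmod.
  by case/orP => /eqP -> _.
apply/funext => k; rewrite pmod /chi4.
case: ifPn => [/eqP -> //|k1]; case: ifPn => [/eqP -> //|k3].
by apply/eqP/negbNE; rewrite nz coprimez4 modz_mod negb_or k1 k3.
Qed.

(* Main.v *)
Require Import Defs.
From HB Require Import structures.
From mathcomp Require Import all_boot all_order all_algebra.
From mathcomp Require Import all_classical all_reals all_analysis.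
From mathcomp Require Import complex.
From mathcomp Require Import fingroup perm separable cyclotomic zify ring lra.
Set Implicit Arguments.
Unset Strict Implicit.
Unset Printing Implicit Defensive.
Import Order.TTheory GRing.Theory Num.Theory.
Import numFieldNormedType.Exports.
Local Open Scope classical_set_scope.
Local Open Scope ring_scope.
Local Open Scope complex_scope.

(** Let [G] be the group of units modulo [n] up to sign and [f a = sec (2 pi a / n)],
    an even function. The permutation matrices of multiplication on [G] commute and
    have finite order, so they are simultaneously diagonalisable over the complex
    numbers; the diagonal entries are exactly the even characters, and the group
    determinant [det (f (a^-1 b))] is the product over them of
    [sum_(a in G) chi a * f a]. Passing from [f (a^-1 b)] to [f (a b)] costs the
    signature of the inversion of [G], which is governed by the number of solutions of
    [a ^ 2 = +-1], computed by the Chinese remainder theorem: this is [eps_sign n].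

    For the L-value, [chi] is expanded in cosines of [2 pi j k / n] and
    [chi4 k = sin (k pi / 2)], so that [L (1, chi chi4)] reduces to the Fourier series
    of a square wave, i.e. to [sum_k sin (k t) / k = (pi - t) / 2]. The remaining
    finite sum over [j] is a Dirichlet kernel, which at [4 t] is a secant; this is
    where the factor [chi 4] comes from. Finally the product of the [chi 4] is the
    determinant of a permutation matrix, hence its own inverse. *)

(** * The sawtooth and square wave series *)

(** The sum telescopes: [2 sin (x/2) cos (j x)] is the difference of the sines of [(j + 1/2) x] and
    [(j - 1/2) x]. *)
Lemma dirichlet_kernel (R : realType) (J : nat) (x : R) :
  sin (x / 2) * (1 + 2 * \sum_(j < J) cos (j.+1%:R * x)) =
  sin ((J%:R + 1 / 2) * x).
Proof.
elim: J => [|J IH].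
  by rewrite big_ord0 mulr0 addr0 mulr1 add0r mul1r mulrC.
rewrite big_ord_recr /= [2 * _]mulrDr addrA mulrDr IH.
have -> : (J%:R + 1 / 2) * x = J.+1%:R * x - x / 2 by rewrite -natr1; field.
have -> : (J.+1%:R + 1 / 2) * x = J.+1%:R * x + x / 2 by field.
by rewrite sinB sinD; ring.
Qed.

Lemma is_derive_scale_arg (R : realType) (f : R -> R) (c x d : R) :
  is_derive (c * x) 1 f d -> is_derive x 1 (fun y : R => f (c * y)) (d * c).
Proof.
move=> df; have -> : (fun y => f (c * y)) = f \o (c \*: (@id R)) by [].
by apply: is_derive1_comp; apply: is_derive_eq; rewrite /GRing.scale /= mulr1.
Qed.

Lemma is_derive_sin_series (R : realType) (K : nat) (x : R) :
  is_derive x 1 (fun y : R => \sum_(k < K) sin (k.+1%:R * y) / k.+1%:R)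
    (\sum_(k < K) cos (k.+1%:R * x)).
Proof.
elim: K => [|K IH].
  rewrite big_ord0; have -> : (fun y : R => \sum_(k < 0) sin (k.+1%:R * y) / k.+1%:R) = cst 0.
    by apply/funext => y; rewrite big_ord0.
  exact: is_derive_cst.
rewrite big_ord_recr /=.
have -> : (fun y : R => \sum_(k < K.+1) sin (k.+1%:R * y) / k.+1%:R) =
  (fun y : R => \sum_(k < K) sin (k.+1%:R * y) / k.+1%:R) +
  (K.+1%:R^-1 \*: (fun y : R => sin (K.+1%:R * y))).
  apply/funext => y; rewrite big_ord_recr /=; congr (_ + _).
  by rewrite mulrC.
apply: is_deriveD.
have -> : cos (K.+1%:R * x) = K.+1%:R^-1 *: (cos (K.+1%:R * x) * K.+1%:R).
  by rewrite /GRing.scale /= mulrCA mulVf ?mulr1 // pnatr_eq0.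
by apply: is_deriveZ; apply: is_derive_scale_arg.
Qed.

Lemma sinMpi (R : realType) (k : nat) : sin (k%:R * pi) = 0 :> R.
Proof.
elim: k => [|k IH]; first by rewrite mul0r sin0.
by rewrite -natr1 mulrDl mul1r sinDpi IH oppr0.
Qed.

Lemma cos_halfMpi (R : realType) (k : nat) : cos ((k%:R + 1 / 2) * pi) = 0 :> R.
Proof.
have -> : (k%:R + 1 / 2) * pi = k%:R * pi + pi / 2 :> R by field.
by rewrite cosDpihalf sinMpi oppr0.
Qed.

(** Integration by parts in disguise: the error has derivative [sin (c x) / (2 sin (x / 2))] with
    [c = K + 1/2], whose oscillation gains a factor [1 / c]. The mean value theorem on [[t, pi]]
    replaces the integral. *)
Lemma sawtooth_bound (R : realType) (t : R) (K : nat) : 0 < t <= pi ->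
  `| \sum_(k < K) sin (k.+1%:R * t) / k.+1%:R - (pi - t) / 2 | <=
  (pi / sin (t / 2) ^+ 2 + (sin (t / 2))^-1) * K.+1%:R^-1.
Proof.
move=> /andP[t0 tpi]; set s := sin (t / 2).
have p0 := pi_gt0 R.
have sx x : t <= x <= pi -> s <= sin (x / 2).
  move=> /andP[tx xpi]; rewrite /s leNgt ltr_sin -?leNgt ?in_itv /=; lra.
have s0 : 0 < s by apply: sin_gt0_pi; lra.
set c : R := K%:R + 1 / 2.
have cK : K.+1%:R / 2 <= c.
  by rewrite /c -natr1; have : 0 <= K%:R :> R by []; lra.
have c0 : 0 < c by apply: lt_le_trans cK; rewrite divr_gt0.
(* The added cosine term cancels the Dirichlet kernel upon differentiation, leaving [dG] of size
   [1 / c]; it also vanishes at [pi], so that [G pi = 0]. *)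
pose G (x : R) : R := \sum_(k < K) sin (k.+1%:R * x) / k.+1%:R - (pi - x) / 2
   + cos (c * x) / (2 * c * sin (x / 2)).
pose dG (x : R) : R := - (cos (c * x) * cos (x / 2) / (4 * c * sin (x / 2) ^+ 2)).
have dGP x : t <= x <= pi -> is_derive x 1 G (dG x).
  move=> tx; have sx0 : sin (x / 2) != 0.
    by rewrite gt_eqF // (lt_le_trans s0) // sx.
  have dK := is_derive_sin_series K x.
  have d1 : is_derive x 1 (fun y : R => cos (c * y)) (- sin (c * x) * c).
    exact: is_derive_scale_arg.
  have d2 : is_derive x 1 (fun y : R => (sin (2^-1 * y))^-1)
      (- sin (2^-1 * x) ^- 2 * (cos (2^-1 * x) * 2^-1)).
    apply: is_deriveV; first by rewrite mulrC.
    exact: is_derive_scale_arg.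
  have -> : G = (fun y : R => \sum_(k < K) sin (k.+1%:R * y) / k.+1%:R)
     + (2^-1 \*: (id - cst pi)) +
     ((2 * c)^-1 \*: ((fun y : R => cos (c * y)) * (fun y : R => (sin (2^-1 * y))^-1))).
    apply/funext => y; rewrite /G /=; congr (_ + _ + _).
      by rewrite -[RHS]/(2^-1 * (y - pi)); field.
    by rewrite /GRing.scale /= invfM [y / 2]mulrC mulrCA.
  apply: is_derive_eq; rewrite /dG /GRing.scale /=.
  set D := \sum_(k < K) cos (k.+1%:R * x).
  have -> : D = (sin (c * x) / sin (x / 2) - 1) / 2.
    by rewrite -dirichlet_kernel -/D; field.
  rewrite [2^-1 * x]mulrC.
  have key (C S w k z : R) : z != 0 -> w != 0 ->
    (S / w - 1) / 2 + 2^-1 * (1 - 0) +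
    (2 * z)^-1 * (C * (- w ^- 2 * (k / 2)) + w^-1 * (- S * z)) =
    - (C * k / (4 * z * w ^+ 2)).
    by move=> z0 w0; field; rewrite z0 w0.
  by apply: key => //; rewrite gt_eqF.
have cG : {within `[t, pi], continuous G}.
  apply: derivable_within_continuous => x; rewrite in_itv /= => xt.
  by have [] := dGP x xt.
have [|x xt] := @MVT_segment _ G dG t pi tpi _ cG.
  by move=> x; rewrite in_itv /= => xt; apply: dGP; lra.
have -> : G pi = 0.
  rewrite /G subrr mul0r subr0 /c cos_halfMpi mul0r addr0.
  by apply: big1 => k _; rewrite sinMpi mul0r.
rewrite sub0r => Gt.
rewrite in_itv /= in xt; have sx0 := sx x xt.
set T := (X in `|X|).
have -> : T = - (dG x * (pi - t)) - cos (c * t) / (2 * c * s).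
  by rewrite -Gt /G opprK addrK.
rewrite (le_trans (ler_normB _ _)) // normrN [leRHS]mulrDl lerD //.
  rewrite normrM normrN.
  have -> : pi / s ^+ 2 / K.+1%:R = (K.+1%:R * s ^+ 2)^-1 * pi.
    by rewrite [in RHS]invfM [RHS]mulrC [_^-1 * _]mulrC mulrA.
  rewrite ler_pM //; last by rewrite ger0_norm; lra.
  rewrite normrM normrM normrV ?unitfE; last first.
    by rewrite !mulf_neq0 ?expf_neq0 // gt_eqF // (lt_le_trans s0).
  have w0 : 0 < sin (x / 2) by apply: lt_le_trans sx0.
  rewrite -[leRHS]mul1r ler_pM // ?invr_ge0 //.
    by rewrite -[1]mulr1 ler_pM // cos_max.
  rewrite ger0_norm ?mulr_ge0 ?exprn_ge0 //; try exact: ltW.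
  rewrite lef_pV2 ?posrE ?mulr_gt0 ?exprn_gt0 //.
  rewrite ler_pM ?exprn_ge0 ?ler_pXn2r ?nnegrE //; try exact: ltW.
  by lra.
rewrite normrM normrV ?unitfE ?mulf_neq0 ?gt_eqF //.
rewrite [`|2 * c * s|]ger0_norm ?mulr_ge0 //; try exact: ltW.
rewrite -[s^-1 / _]invfM -[leRHS]mul1r.
rewrite ler_pM ?invr_ge0 ?mulr_ge0 ?cos_max //; try exact: ltW.
rewrite lef_pV2 ?posrE ?mulr_gt0 // [s * _]mulrC ler_pM2r //.
by lra.
Qed.

Lemma cosDnatM2pi (R : realType) (k : nat) (x : R) :
  cos (x + k%:R * (2 * pi)) = cos x.
Proof. by rewrite [2 * pi]mulr_natl mulr_natl (periodicn (@cosD2pi R)). Qed.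

Lemma sinDnatM2pi (R : realType) (k : nat) (x : R) :
  sin (x + k%:R * (2 * pi)) = sin x.
Proof. by rewrite [2 * pi]mulr_natl mulr_natl (periodicn (@sinD2pi R)). Qed.

(** The bound settles [t <= pi]; both sides change sign under [t -> 2 pi - t], which gives the
    rest. *)
Lemma sawtooth_cvg (R : realType) (t : R) : 0 < t < 2 * pi ->
  (\sum_(k < K) sin (k.+1%:R * t) / k.+1%:R) @[K --> \oo] --> (pi - t) / 2.
Proof.
have half (s : R) : 0 < s <= pi ->
    (\sum_(k < K) sin (k.+1%:R * s) / k.+1%:R) @[K --> \oo] --> (pi - s) / 2.
  move=> spi; set C := pi / sin (s / 2) ^+ 2 + (sin (s / 2))^-1.
  have h : (C * harmonic K) @[K --> \oo] --> (0 : R).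
    by rewrite -[0](mulr0 C); apply: cvgMl_tmp; exact: cvg_harmonic.
  apply/subr_cvg0; apply/norm_cvg0P.
  apply: (squeeze_cvgr _ (cvg_cst 0) h) => /=.
  apply: nearW => K; rewrite normr_ge0 /=; exact: sawtooth_bound.
move=> /andP[t0 t2]; have [tpi|tpi] := leP t pi; first by apply: half; rewrite t0.
have -> : (fun K : nat => \sum_(k < K) sin (k.+1%:R * t) / k.+1%:R) =
    (fun K : nat => - \sum_(k < K) sin (k.+1%:R * (2 * pi - t)) / k.+1%:R).
  apply/funext => K; rewrite -sumrN; apply: eq_bigr => k _.
  by rewrite mulrBr addrC sinDnatM2pi sinN mulNr opprK.
have -> : (pi - t) / 2 = - ((pi - (2 * pi - t)) / 2) by field.
by apply: cvgN; apply: half; lra.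
Qed.

(** By product-to-sum, this is the mean of the sawtooths at [pi/2 + t] and [pi/2 - t]. Once
    [t > pi/2] the second angle is negative, and oddness turns the sum into a difference. The jump
    is at [t = pi/2]. *)
Lemma square_wave_cvg (R : realType) (t : R) : 0 <= t <= pi -> t != pi / 2 ->
  (\sum_(k < K) sin (k.+1%:R * (pi / 2)) * cos (k.+1%:R * t) / k.+1%:R)
    @[K --> \oo] --> (if t < pi / 2 then pi / 4 else - (pi / 4)).
Proof.
move=> /andP[t0 tpi] tne; have p0 := pi_gt0 R.
pose S (s : R) (K : nat) := \sum_(k < K) sin (k.+1%:R * s) / k.+1%:R.
have S1 : S (pi / 2 + t) K @[K --> \oo] --> (pi - (pi / 2 + t)) / 2.
  by apply: sawtooth_cvg; lra.
case: ltP => [tlt|tge].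
  have S2 : S (pi / 2 - t) K @[K --> \oo] --> (pi - (pi / 2 - t)) / 2.
    by apply: sawtooth_cvg; lra.
  have -> : pi / 4 = 2^-1 * ((pi - (pi / 2 + t)) / 2 + (pi - (pi / 2 - t)) / 2) :> R.
    by field.
  rewrite [X in X @ _](_ : _ = fun K => 2^-1 * (S (pi / 2 + t) K + S (pi / 2 - t) K)).
    by apply: cvgMl_tmp; exact: cvgD.
  apply/funext => K; rewrite /S -big_split mulr_sumr; apply: eq_bigr => k _ /=.
  by rewrite [_ * (pi / 2 + t)]mulrDr [_ * (pi / 2 - t)]mulrBr sinD sinB; field.
have tgt : pi / 2 < t by rewrite lt_def tne.
have S2 : S (t - pi / 2) K @[K --> \oo] --> (pi - (t - pi / 2)) / 2.
  by apply: sawtooth_cvg; lra.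
have -> : - (pi / 4) = 2^-1 * ((pi - (pi / 2 + t)) / 2 - (pi - (t - pi / 2)) / 2) :> R.
  by field.
rewrite [X in X @ _](_ : _ = fun K => 2^-1 * (S (pi / 2 + t) K - S (t - pi / 2) K)).
  by apply: cvgMl_tmp; exact: cvgB.
apply/funext => K; rewrite /S -sumrB mulr_sumr; apply: eq_bigr => k _ /=.
by rewrite [_ * (pi / 2 + t)]mulrDr [_ * (t - pi / 2)]mulrBr sinD sinB; field.
Qed.

(** * Finite cosine sums, sine form of [chi4], and auxiliary facts on limits and residues *)

Lemma sin_pi_frac_neq0 (R : realType) (n d : nat) : (0 < n)%N -> ~~ (n %| d)%N ->
  sin (d%:R * pi / n%:R) != 0 :> R.
Proof.
move=> n0 nd; set r := (d %% n)%N; have r0 : (0 < r)%N by rewrite lt0n.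
have nR : n%:R != 0 :> R by rewrite pnatr_eq0 -lt0n.
have -> : d%:R * pi / n%:R = r%:R * pi / n%:R + pi *+ (d %/ n) :> R.
  by rewrite [in LHS](divn_eq d n) -/r natrD natrM -[pi *+ _]mulr_natl; field.
rewrite (alternatingn (@sinDpi R)) mulf_neq0 ?signr_eq0 // gt_eqF // sin_gt0_pi //.
rewrite divr_gt0 ?mulr_gt0 ?pi_gt0 ?ltr0n //= ltr_pdivrMr ?ltr0n //.
by rewrite mulrC ltr_pM2l ?pi_gt0 // ltr_nat ltn_pmod.
Qed.

(** Orthogonality of the [n]-th roots of unity, with [j] and [-j] paired. Off the multiples of [n],
    the Dirichlet kernel with [n./2] terms is a multiple of [sin (d pi) = 0]. *)
Lemma odd_cos_sum (R : realType) (n d : nat) : odd n ->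
  1 + 2 * \sum_(j < n./2) cos (j.+1%:R * (2 * pi * d%:R / n%:R)) =
  (if (n %| d)%N then n%:R else 0 : R).
Proof.
move=> n_odd; have n0 : (0 < n)%N by case: n n_odd.
have nR : n%:R != 0 :> R by rewrite pnatr_eq0 -lt0n.
have nE : n%:R = 2 * n./2%:R + 1 :> R.
  by rewrite -[in LHS](odd_double_half n) n_odd -mul2n natrD natrM addrC.
case: ifPn => [/dvdnP[q ->]|nd].
  have cos1 (j : nat) : cos (j.+1%:R * (2 * pi * (q * n)%:R / n%:R)) = 1 :> R.
    rewrite -[RHS]cos0 -[in RHS](cosDnatM2pi (j.+1 * q)) !natrM add0r.
    by congr cos; field.
  under eq_bigr do rewrite cos1.
  by rewrite sumr_const card_ord addrC -nE.
have := sin_pi_frac_neq0 R n0 nd.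
have -> : d%:R * pi / n%:R = 2 * pi * d%:R / n%:R / 2 :> R by field.
move=> sn0; apply: (mulfI sn0); rewrite dirichlet_kernel mulr0.
have -> : (n./2%:R + 1 / 2) * (2 * pi * d%:R / n%:R) = d%:R * pi :> R.
  by rewrite nE; field; rewrite -nE.
exact: sinMpi.
Qed.

Lemma chi4_sin (R : realType) (k : nat) :
  chi4 R k%:Z = (sin (k%:R * (pi / 2)))%:C.
Proof.
have -> : chi4 R k%:Z = chi4 R (k %% 4)%N%:Z by rewrite /chi4 -modz_nat modz_mod.
rewrite [in RHS](divn_eq k 4) natrD natrM mulrDl addrC.
have -> : (k %/ 4)%:R * 4 * (pi / 2) = (k %/ 4)%:R * (2 * pi) :> R by field.
rewrite sinDnatM2pi.
have : (k %% 4 < 4)%N by rewrite ltn_pmod.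
case: (k %% 4)%N => [|[|[|[|]]]] //= _; rewrite /chi4 /=.
- by rewrite mul0r sin0.
- by rewrite mul1r sin_pihalf.
- have -> : 2 * (pi / 2) = pi :> R by field.
  by rewrite sinpi.
have -> : 3 * (pi / 2) = pi / 2 + pi :> R by field.
by rewrite sinDpi sin_pihalf rmorphN.
Qed.

Lemma cvg_real_complex (R : realType) (u : nat -> R) (l : R) :
  u K @[K --> \oo] --> l ->
  ((u K)%:C : R[i]^o) @[K --> \oo] --> (l%:C : R[i]^o).
Proof.
move=> ul; apply/cvgrPdist_lt => e e0.
(* A positive element of [R[i]] has zero imaginary part, so it is a real radius. *)
have [r eE] : exists r : R, e = r%:C.
  by exists (complex.Re e); move: e0; rewrite ltcE /= => /andP[/eqP e2 _]; case: e e2 => a b /= ->.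
rewrite eE ltcR in e0.
have h : \forall K \near \oo, `|l - u K| < r.
  by move/cvgrPdist_lt : ul => /(_ r e0).
apply: filterS h => K /= h.
by rewrite eE -rmorphB /= normc_def /= expr0n /= addr0 sqrtr_sqr ltcR; exact: h.
Qed.

Lemma dirichlet_char_modz (R : realType) (n : nat) (chi : int -> R[i]) (a : int) :
  dirichlet_char n chi -> chi (a %% n%:Z)%Z = chi a.
Proof.
case=> per _ _.
have perM (q : nat) b : chi (b + q%:Z * n%:Z) = chi b.
  elim: q => [|q IH]; first by rewrite mul0r addr0.
  by rewrite intS mulrDl mul1r addrCA addrC per.
rewrite [in RHS](divz_eq a n%:Z) addrC; case: (a %/ n%:Z)%Z => q; first by rewrite perM.
by rewrite NegzE -[RHS](perM q.+1) mulNr subrK.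
Qed.

Lemma reindex_modn_mul (V : nmodType) (n a : nat) (F : nat -> V) :
  coprime a n -> (forall t, F (t %% n)%N = F t) ->
  \sum_(t < n) F (a * t)%N = \sum_(t < n) F t.
Proof.
case: n => [|n] co Fmod; first by rewrite !big_ord0.
pose f (t : 'I_n.+1) : 'I_n.+1 := inord ((a * t) %% n.+1).
have fE t : f t = ((a * t) %% n.+1)%N :> nat by rewrite inordK // ltn_pmod.
have f_inj : injective f.
  move=> s t /(congr1 val) /=; rewrite !fE => /eqP.
  have red (x y : nat) : (x <= y < n.+1)%N -> a * x == a * y %[mod n.+1] -> x = y.
    move=> /andP[xy yn]; rewrite eq_sym eqn_mod_dvd ?leq_mul2l ?xy ?orbT //.
    rewrite -mulnBr Gauss_dvdr 1?coprime_sym // => /dvdn_leq.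
    by case: (posnP (y - x)%N) => [|d0 /(_ isT)]; lia.
  move=> e; apply: val_inj; have [st|ts] := leqP s t.
    by apply: red e; rewrite st ltn_ord.
  by symmetry; apply: red; rewrite 1?eq_sym // ltnW // ltn_ord.
rewrite [RHS](reindex_inj f_inj); apply: eq_bigr => t _.
by rewrite fE Fmod.
Qed.

Lemma cvg_sum_ord (K : numFieldType) (V : normedModType K) (m : nat)
    (f : 'I_m -> nat -> V) (l : 'I_m -> V) :
  (forall i, f i N @[N --> \oo] --> l i) ->
  (\sum_i f i N) @[N --> \oo] --> \sum_i l i.
Proof. by move=> fl; apply: cvg_big => [|i _]; [exact: add_continuous|exact: fl]. Qed.

(** * L-values of even characters twisted by [chi4] *)

Section EvenCharacterLValue.
Variables (R : realType) (n : nat) (chi : int -> R[i]).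
Hypotheses (n3 : (3 <= n)%N) (n_odd : odd n).
Hypotheses (chiD : dirichlet_char n chi) (chiE : even_char chi).

Let x (t : nat) : R := 2 * pi * t%:R / n%:R.

Let n0 : (0 < n)%N. Proof. exact: leq_trans n3. Qed.
Let nR : n%:R != 0 :> R. Proof. by rewrite pnatr_eq0 -lt0n. Qed.
Let nC : n%:R != 0 :> R[i]. Proof. by rewrite pnatr_eq0 -lt0n. Qed.

Lemma even_charN a : chi (- a) = chi a.
Proof. by case: chiD => _ M _; rewrite -mulN1r M chiE mul1r. Qed.

(** Product-to-sum makes the kernel [n / 2] times the indicators of [t = k] and [t = - k] modulo
    [n]; evenness of [chi] merges the two contributions. *)
Lemma even_char_cos_expand (k : nat) :
  n%:R * chi k%:Z = \sum_(t < n) chi t%:Z *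
    (1 + 2 * \sum_(j < n./2) cos (j.+1%:R * x k) * cos (j.+1%:R * x t))%:C.
Proof.
pose K (d : nat) : R := 1 + 2 * \sum_(j < n./2) cos (j.+1%:R * x d).
have KE d : K d = (if (n %| d)%N then n%:R else 0) by exact: odd_cos_sum.
have prodE (t : nat) :
    1 + 2 * \sum_(j < n./2) cos (j.+1%:R * x k) * cos (j.+1%:R * x t) =
    2^-1 * K `|k - t|%N + 2^-1 * K (k + t)%N.
  rewrite /K [in LHS]mulr_sumr.
  set A := \sum_(_ < _) _; set B := \sum_(_ < _) _; set C := \sum_(_ < _) _.
  suff -> : A = B + C by field.
  rewrite /A /B /C -big_split; apply: eq_bigr => j _ /=.
  have -> : cos (j.+1%:R * x `|k - t|%N) = cos (j.+1%:R * (x k - x t)).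
    have [kt|tk] := leqP t k.
      by rewrite distnEl // /x natrB //; congr cos; field.
    rewrite distnEr 1?ltnW // -[RHS]cosN /x natrB; last exact: ltnW.
    by congr cos; field.
  have -> : x (k + t)%N = x k + x t by rewrite /x natrD; field.
  by rewrite mulrBr mulrDr cosB cosD; field.
under eq_bigr do rewrite prodE rmorphD mulrDr !rmorphM /=.
have modE (a b : int) : (n%:Z %| a - b)%Z -> chi a = chi b.
  move=> ab; rewrite -(dirichlet_char_modz a chiD) -(dirichlet_char_modz b chiD).
  by congr chi; apply/eqP; rewrite eqz_mod_dvd.
(* Extraction of the single residue [a] at which the kernel is nonzero; it serves for [t = k] and
   for [t = - k]. *)
have pick (f : nat -> nat) (a : nat) : (a < n)%N ->
    (forall t, (t < n)%N -> (n %| f t)%N = (t == a)) -> chi a%:Z = chi k%:Z ->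
   \sum_(t < n) chi t%:Z * ((2^-1)%:C * (K (f t))%:C) = (2^-1)%:C * n%:R * chi k%:Z.
  move=> an fE <-; rewrite (bigD1 (Ordinal an)) //= big1 => [|t ta]; last first.
    by rewrite KE fE // ifN ?mulr0.
  rewrite addr0 KE fE // eqxx mulrC rmorph_nat; ring.
rewrite big_split /=.
have km : (k %% n < n)%N by rewrite ltn_pmod.
rewrite (pick (fun t => `|k - t|%N) (k %% n)%N) //; last first.
- by rewrite -modz_nat dirichlet_char_modz.
- move=> t tn; rewrite -[X in (_ == X)%N]/(k %% n)%N eq_sym -[t in RHS](modn_small tn).
  have [kt|tk] := leqP t k; first by rewrite distnEl // eqn_mod_dvd.
  by rewrite distnEr 1?ltnW // eq_sym eqn_mod_dvd // ltnW.
(* The outer reduction covers [n %| k], where [n - k %% n] is [n] itself. *)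
have km' : ((n - k %% n) %% n < n)%N by rewrite ltn_pmod.
have e : (k + (n - k %% n) = (k %/ n).+1 * n)%N.
  by rewrite {1}(divn_eq k n) mulSn; lia.
rewrite (pick (fun t => (k + t)%N) ((n - k %% n) %% n)%N) //; last first.
- rewrite -modz_nat dirichlet_char_modz // -[RHS]even_charN; apply: modE.
  by rewrite opprK addrC -PoszD e PoszM dvdz_mull.
- move=> t tn; rewrite -[t in RHS](modn_small tn) eq_sym -(eqn_modDl k) eq_sym.
  by rewrite e modnMl.
have half : (2^-1)%:C + (2^-1)%:C = 1 :> R[i].
  by rewrite -rmorphD /= [_ + _](_ : _ = 1) //; field.
by rewrite -mulrDl -mulrDl half mul1r.
Qed.

Lemma cpow_nat1 (k : nat) : cpow_nat k.+1 (1 : R[i]) = k.+1%:R.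
Proof.
rewrite /cpow_nat /= mul0r cos0 sin0 powRr1 //.
by rewrite -[1 +i* 0]/(1 : R[i]) mulr1 rmorph_nat.
Qed.

Let U (j K : nat) : R :=
  \sum_(k < K) sin (k.+1%:R * (pi / 2)) * cos (k.+1%:R * x j) / k.+1%:R.

(** The sign of [cos (x j)] for [j <= n./2]: the angle [x j] passes [pi / 2] when [4 j] passes
    [n]. *)
Let sg (j : nat) : R := if (4 * j < n)%N then 1 else -1.

Lemma square_wave_root_cvg (j : nat) : (j <= n./2)%N ->
  U j K @[K --> \oo] --> sg j * (pi / 4).
Proof.
move=> jn; have p0 := pi_gt0 R; have pn0 := lt0r_neq0 p0.
have nR0 : 0 < n%:R :> R by rewrite ltr0n.
have xlt : (x j < pi / 2) = (4 * j < n)%N.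
  rewrite /x ltr_pdivrMr // -[RHS](ltr_nat R) natrM.
  rewrite -(ltr_pM2l (divr_gt0 p0 (ltr0Sn R 1))).
  by congr (_ < _); field.
have -> : sg j * (pi / 4) = if x j < pi / 2 then pi / 4 else - (pi / 4).
  by rewrite /sg xlt; case: ifP => _; rewrite ?mul1r ?mulN1r.
apply: square_wave_cvg.
  rewrite divr_ge0 ?mulr_ge0 //=; last exact: ltW.
  rewrite /x ler_pdivrMr // -mulrA mulrCA ler_pM2l // -natrM ler_nat.
  by rewrite mul2n -geq_half_double.
(* Falling on the jump [x j = pi / 2] would force [4 j = n], against the oddness of [n]. *)
apply/eqP => e; have : (4 * j)%:R = n%:R :> R.
  have -> : (4 * j)%:R = x j * (2 / pi) * n%:R :> R.
    by rewrite natrM /x; move: pn0; move: (pi) => p pn0; field; rewrite nR pn0.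
  by rewrite e; move: pn0; move: (pi) => p pn0; field.
move/eqP; rewrite eqr_nat => /eqP e4; move: n_odd; rewrite -e4 oddM //.
Qed.

(** Up to [pi / 4], the limit of the series multiplying [chi t]; the leading [1] is the term
    [j = 0], where the sign is [1]. *)
Let W (t : nat) : R := 1 + 2 * \sum_(j < n./2) sg j.+1 * cos (j.+1%:R * x t).

(** After the cosine expansion of [chi], the sum over [k] is innermost and the sums over [t] and [j]
    are finite, so the conditionally convergent limit is taken term by term. *)
Lemma dirichletL_even_char_cos :
  dirichletL 1 (fun a => chi a * chi4 R a) =
  (pi / 4)%:C / n%:R * \sum_(t < n) chi t%:Z * (W t)%:C.
Proof.
rewrite /dirichletL; apply: (@cvg_lim R[i]^o); first exact: norm_hausdorff.
(* [V t N] is what multiplies [chi t / n] in the [N]-th partial sum; the constant term of the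
   expansion is [U 0], since [x 0 = 0]. *)
pose V (t K : nat) : R :=
  U 0 K + 2 * \sum_(j < n./2) U j.+1 K * cos (j.+1%:R * x t).
have Vcvg t : V t K @[K --> \oo] --> pi / 4 * W t.
  rewrite /W mulrDr mulr1 mulrCA mulr_sumr.
  apply: cvgD.
    have := @square_wave_root_cvg 0 isT.
    by rewrite /sg muln0 n0 mul1r.
  apply: cvgMl_tmp.
  apply: (@cvg_sum_ord R R^o _ (fun j K => U j.+1 K * cos (j.+1%:R * x t))) => j.
  rewrite [pi / 4 * (sg _ * _)]mulrCA [sg _ * (pi / 4 * _)]mulrA; apply: (@cvgMr_tmp R).
  exact: square_wave_root_cvg.
have -> : (fun N => \sum_(1 <= k < N.+1) chi k%:Z * chi4 R k%:Z / cpow_nat k 1) =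
    (fun N => \sum_(t < n) (n%:R^-1 * chi t%:Z) * (V t N)%:C).
  apply/funext => N.
  rewrite big_add1 /= big_mkord.
  have VE t : V t N = \sum_(k < N) sin (k.+1%:R * (pi / 2)) / k.+1%:R *
     (1 + 2 * \sum_(j < n./2) cos (j.+1%:R * x k.+1) * cos (j.+1%:R * x t)).
    have -> : V t N = U 0 N + \sum_(k < N) \sum_(j < n./2) 2 *
        (sin (k.+1%:R * (pi / 2)) * cos (k.+1%:R * x j.+1) / k.+1%:R *
         cos (j.+1%:R * x t)).
      rewrite exchange_big /V mulr_sumr; congr (_ + _); apply: eq_bigr => j _.
      by rewrite mulr_suml mulr_sumr.
    rewrite -big_split; apply: eq_bigr => k _ /=.
    rewrite mulrDr mulr1 {1}/x mulr0 mul0r mulr0 cos0 mulr1; congr (_ + _).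
    rewrite !mulr_sumr; apply: eq_bigr => j _.
    have -> : k.+1%:R * x j.+1 = j.+1%:R * x k.+1 by rewrite /x; field.
    by ring.
  under [RHS]eq_bigr do rewrite VE rmorph_sum /= mulr_sumr.
  rewrite exchange_big; apply: eq_bigr => k _ /=.
  rewrite cpow_nat1 chi4_sin.
  have -> : chi k.+1%:Z = n%:R^-1 * (n%:R * chi k.+1%:Z) by rewrite mulKf.
  rewrite even_char_cos_expand -!mulrA mulr_suml mulr_sumr.
  apply: eq_bigr => t _; rewrite rmorphM fmorph_div /= rmorph_nat; ring.
have -> : (pi / 4)%:C / n%:R * \sum_(t < n) chi t%:Z * (W t)%:C =
    \sum_(t < n) (n%:R^-1 * chi t%:Z) * (pi / 4 * W t)%:C.
  by rewrite mulr_sumr; apply: eq_bigr => t _; rewrite [in RHS]rmorphM /=; ring.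
apply: (@cvg_sum_ord _ R[i]^o _ (fun t N => n%:R^-1 * chi t%:Z * (V t N)%:C)) => t.
apply: (@cvgMl_tmp R[i]); exact: cvg_real_complex.
Qed.

(** The sign [sg] is twice the indicator of [4 j < n] minus [1], so [W] is twice a Dirichlet kernel
    of length [n %/ 4] minus the full one, which vanishes. *)
Let WE t : ~~ (n %| t)%N ->
  W t = 2 * sin (((n %/ 4)%:R + 1 / 2) * x t) / sin (x t / 2).
Proof.
move=> nt; have := sin_pi_frac_neq0 R n0 nt.
have -> : t%:R * pi / n%:R = x t / 2 by rewrite /x; field.
move=> s0; apply: (canRL (mulfK s0)); rewrite -dirichlet_kernel.
have n4 : (n %/ 4 <= n./2)%N by rewrite -divn2 leq_div2l.
have -> : W t = 2 * (1 + 2 * \sum_(j < n %/ 4) cos (j.+1%:R * x t)) -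
    (1 + 2 * \sum_(j < n./2) cos (j.+1%:R * x t)).
  rewrite /W (big_ord_widen n./2 (fun j => cos (j.+1%:R * x t)) n4).
  rewrite [in RHS]big_mkcond.
  set A := \sum_(_ < _) _; set B := \sum_(_ < _) _; set C := \sum_(_ < _) _.
  suff -> : A = 2 * B - C by ring.
  rewrite /A /B /C mulr_sumr -sumrB; apply: eq_bigr => j _; rewrite /sg.
  (* The strict and the weak inequality agree because [4 * j.+1] is even and [n] odd. *)
  have -> : (4 * j.+1 < n)%N = (j < n %/ 4)%N.
    rewrite leq_divRL // mulnC ltn_neqAle; case: eqP => //= e.
    by have := congr1 odd e; rewrite oddM andbF n_odd.
  by case: ifP => _; ring.
by rewrite [1 + 2 * \sum_(j < n./2) _]odd_cos_sum // (negbTE nt) subr0 mulrAC mulrA.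
Qed.

(** With [y = 2 pi t / n], the numerator angle is [(n + 2 - n %% 4) y] and [n y] is a multiple of
    [2 pi]. What remains is [sin y] or [- sin y] according to [n %% 4], over
    [sin (2 y) = 2 sin y cos y]. *)
Let W4E t : ~~ (n %| t)%N ->
  (W (4 * t))%:C = chi4 R n%:Z * (sec (2 * t%:R * pi / n%:R))%:C.
Proof.
move=> nt; have n4 : coprime n 4 by rewrite coprime_sym (@coprime_pexpl 2 2) // coprime2n.
have nt4 : ~~ (n %| 4 * t)%N by rewrite Gauss_dvdr.
have nt2 : ~~ (n %| 2 * t)%N by rewrite Gauss_dvdr // coprime_sym coprime2n.
rewrite WE //; set y := 2 * t%:R * pi / n%:R.
have sy : sin y != 0.
  have := sin_pi_frac_neq0 R n0 nt2.
  by have -> : (2 * t)%:R * pi / n%:R = y by rewrite /y natrM.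
have s2y : sin (2 * y) != 0.
  have := sin_pi_frac_neq0 R n0 nt4.
  by have -> : (4 * t)%:R * pi / n%:R = 2 * y by rewrite /y natrM; field.
have e2y : sin (2 * y) = 2 * (cos y * sin y) by rewrite mulr_natl sin_mulr2n mulr_natl.
have cy : cos y != 0.
  by move: s2y; rewrite e2y; apply: contra_neq => ->; rewrite mul0r mulr0.
have -> : x (4 * t) / 2 = 2 * y by rewrite /x /y natrM; field.
rewrite e2y /sec.
have ny : n%:R * y = t%:R * (2 * pi) by rewrite /y; field.
have nE : n%:R = 4 * (n %/ 4)%:R + (n %% 4)%:R :> R.
  by rewrite [in LHS](divn_eq n 4) natrD natrM mulrC.
have -> : ((n %/ 4)%:R + 1 / 2) * x (4 * t) = (2 - (n %% 4)%:R) * y + t%:R * (2 * pi).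
  rewrite -ny [in RHS]nE.
  have -> : x (4 * t) = 4 * y by rewrite /x /y natrM; field.
  by field.
rewrite sinDnatM2pi.
have : (n %% 4 < 4)%N by rewrite ltn_pmod.
have : odd (n %% 4) by move: n_odd; rewrite {1}(divn_eq n 4) oddD oddM andbF.
rewrite /chi4 modz_nat; case: (n %% 4)%N => [|[|[|[|]]]] //= _ _.
- rewrite mul1r -[2 - 1]/(1 + 1 - 1) addrK mul1r; congr (_%:C); field.
  by rewrite sy cy.
- have -> : (2 - 3) * y = - y by ring.
  rewrite sinN mulN1r -rmorphN; congr (_%:C); field.
  by rewrite sy cy.
Qed.

(** The substitution [t -> 4 t] permutes the residues because [n] is odd; it pulls out [chi 4] and
    turns [W] into a secant. *)
Lemma dirichletL_even_char :
  dirichletL 1 (fun a => chi a * chi4 R a) =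
  (pi / (4 * n%:R))%:C * chi4 R n%:Z * chi 4 *
    \sum_(t < n) chi t%:Z * (sec (2 * t%:R * pi / n%:R))%:C.
Proof.
rewrite dirichletL_even_char_cos.
have n4 : coprime 4 n by rewrite (@coprime_pexpl 2 2) // coprime2n.
have Wmod t : W (t %% n)%N = W t.
  rewrite /W; congr (1 + 2 * _); apply: eq_bigr => j _; congr (_ * _).
  rewrite -[LHS](cosDnatM2pi (j.+1 * (t %/ n))) /x.
  by congr cos; rewrite [in RHS](divn_eq t n) natrD !natrM; field.
have chimod t : chi (t %% n)%N%:Z = chi t%:Z.
  by rewrite -modz_nat dirichlet_char_modz.
rewrite -(@reindex_modn_mul _ n 4 (fun t => chi t%:Z * (W t)%:C)) //; last first.
  by move=> t; rewrite Wmod chimod.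
have [_ chiM chi0] := chiD.
rewrite !mulr_sumr; apply: eq_bigr => t _; rewrite PoszM chiM.
(* The secant formula excludes [n %| t], but there [chi t = 0]. *)
have [nt|nt] := boolP (n %| t)%N.
  have -> : chi t%:Z = 0.
    apply/eqP; rewrite -[_ == _]negbK chi0 /coprimez /gcdz /=.
    by rewrite (gcdn_idPr nt); apply: contraTneq n3 => -[->].
  by rewrite mulr0 !mul0r !mulr0.
have -> : (pi / (4 * n%:R))%:C = (pi / 4)%:C / n%:R :> R[i].
  by rewrite invfM mulrA [in LHS]rmorphM fmorphV /= rmorph_nat.
by rewrite W4E //; ring.
Qed.
End EvenCharacterLValue.

(** * Characters of a finite commutative ring, up to sign *)

Lemma finComUnitRing_unit_order (A : finComUnitRingType) (x : A) :
  x \is a GRing.unit -> exists2 N, (0 < N)%N & x ^+ N = 1.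
Proof.
move=> ux; exists #[FinRing.Unit ux]%g; first exact: order_gt0.
by rewrite -[x]/(val (FinRing.Unit ux)) -FinRing.val_unitX expg_order.
Qed.

(** The minimal polynomial divides [X^N - 1], which is separable in characteristic zero. *)
Lemma diagonalizable_root_unity (F : numClosedFieldType) (m : nat) (M : 'M[F]_m) (N : nat) :
  (0 < N)%N -> M ^+ N = 1 -> diagonalizable M.
Proof.
case: m M => [|m] M N0 MN; first by rewrite [M]thinmx0; exact: diagonalizable0.
apply/diagonalizableP.
have [rs rsE] := closed_field_poly_normal ('X^N - 1 : {poly F}).
move: rsE; rewrite (monicP (monicXnsubC 1 N0)) scale1r => rsE.
exists rs.
  rewrite -separable_prod_XsubC -rsE separable_Xn_sub_1 // pnatr_eq0 -lt0n //.
rewrite -rsE; apply: mxminpoly_min.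
by rewrite rmorphB rmorph1 rmorphXn /= horner_mx_X MN subrr.
Qed.

Section SignedRegularRepresentation.
Variables (A : finComUnitRingType) (m : nat) (r : 'I_m -> A).

(** Instead of forming the quotient of the units by sign, the development uses this relation with a
    system [r] of representatives. *)
Definition eqpm (x y : A) := (x == y) || (x == - y).

Lemma eqpm_refl x : eqpm x x. Proof. by rewrite /eqpm eqxx. Qed.

Lemma eqpm_sym x y : eqpm x y = eqpm y x.
Proof. by rewrite /eqpm [y == x]eq_sym [y == - x]eq_sym eqr_oppLR. Qed.

Lemma eqpm_trans y x z : eqpm x y -> eqpm y z -> eqpm x z.
Proof.
by case/orP=> /eqP->; case/orP=> /eqP->; rewrite /eqpm ?opprK ?eqxx ?orbT.
Qed.

Lemma eqpm_mul z x y : eqpm x y -> eqpm (z * x) (z * y).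
Proof. by case/orP=> /eqP->; rewrite /eqpm ?mulrN eqxx ?orbT. Qed.

Lemma eqpm_mulI z x y : z \is a GRing.unit -> eqpm (z * x) (z * y) -> eqpm x y.
Proof. by move=> uz /(eqpm_mul z^-1); rewrite !mulKr. Qed.

Lemma eqpm_unit x y : eqpm x y -> (x \is a GRing.unit) = (y \is a GRing.unit).
Proof. by case/orP=> /eqP-> //; rewrite unitrN. Qed.

Lemma eqpm_even (T : Type) (f : A -> T) x y :
  (forall z, f (- z) = f z) -> eqpm x y -> f x = f y.
Proof. by move=> fN /orP[] /eqP->. Qed.

Hypothesis r_unit : forall u, r u \is a GRing.unit.
Hypothesis r_inj : forall u v, eqpm (r u) (r v) -> u = v.
Hypothesis r_surj : forall x, x \is a GRing.unit -> exists u, eqpm x (r u).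

Lemma eqpm_r u v : eqpm (r u) (r v) = (u == v).
Proof. by apply/idP/eqP => [/r_inj | ->] //; exact: eqpm_refl. Qed.

Lemma sum_eqpm (V : pzSemiRingType) (x : A) (F : 'I_m -> V) u : eqpm x (r u) ->
  \sum_v (eqpm (r v) x)%:R * F v = F u.
Proof.
move=> xu; rewrite (bigD1 u) //= (eqpm_sym (r u)) xu mul1r big1 ?addr0 // => v vu.
have [vx|_] := boolP (eqpm (r v) x); last by rewrite mul0r.
by move: (eqpm_trans vx xu); rewrite eqpm_r (negbTE vu).
Qed.

(** Inversion of the group, read on indices; it links the table of [f (a b)] to that of
    [f (a^-1 b)]. *)
Lemma inverse_perm_exists : exists s : {perm 'I_m}, forall j, eqpm (r j * r (s j)) 1.
Proof.
have inv_ex j : exists u, eqpm (r j * r u) 1.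
  have [u ju] := r_surj (etrans (unitrV (r j)) (r_unit j)).
  by exists u; have := eqpm_mul (r j) ju; rewrite eqpm_sym divrr.
pose g j := xchoose (inv_ex j).
have gP j : eqpm (r j * r (g j)) 1 by exact: (xchooseP (inv_ex j)).
have g_inj : injective g.
  move=> i j gij; apply: r_inj; apply: (eqpm_mulI (r_unit (g i))).
  rewrite mulrC {2}gij [X in eqpm _ X]mulrC.
  by apply: eqpm_trans (gP i) _; rewrite eqpm_sym.
by exists (perm g_inj) => j; rewrite permE.
Qed.

Variable F : numClosedFieldType.

(** The regular representation of the units up to sign; on nonunits it is zero, in accordance with
    the vanishing of characters there. *)
Definition pm_mx (x : A) : 'M[F]_m := \matrix_(j, k) (eqpm (r k) (x * r j))%:R.

Lemma pm_mxM x y : pm_mx x *m pm_mx y = pm_mx (x * y).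
Proof.
apply/matrixP => j k; rewrite !mxE.
have [ux|nux] := boolP (x \is a GRing.unit).
  have [u xu] := r_surj (etrans (unitrMr (r j) ux) (r_unit j)).
  under eq_bigr do rewrite !mxE.
  rewrite (sum_eqpm (fun v => (eqpm (r k) (y * r v))%:R) xu).
  congr (nat_of_bool _)%:R; rewrite [x * y]mulrC -mulrA.
  have e := eqpm_mul y xu.
  by apply/idP/idP => h; apply: eqpm_trans h _; rewrite // eqpm_sym.
have h z w : eqpm (r k) (z * x * r w) = false.
  apply/negbTE/negP => /eqpm_unit; rewrite r_unit => /esym.
  by rewrite !unitrM (negbTE nux) andbF.
rewrite [x * y]mulrC h big1 // => l _; rewrite !mxE.
suff -> : eqpm (r l) (x * r j) = false by rewrite mul0r.
apply/negbTE/negP => /eqpm_unit; rewrite r_unit => /esym.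
by rewrite !unitrM (negbTE nux).
Qed.

Lemma pm_mx1 : pm_mx 1 = 1%:M.
Proof. by apply/matrixP => j k; rewrite !mxE mul1r eqpm_r eq_sym. Qed.

Lemma pm_mxN x : pm_mx (- x) = pm_mx x.
Proof.
apply/matrixP => j k; rewrite !mxE mulNr.
by rewrite /eqpm opprK orbC.
Qed.

Lemma pm_mx_nonunit x : x \isn't a GRing.unit -> pm_mx x = 0.
Proof.
move=> nux; apply/matrixP => j k; rewrite !mxE.
suff -> : eqpm (r k) (x * r j) = false by [].
apply/negbTE/negP => /eqpm_unit; rewrite r_unit => /esym.
by rewrite !unitrM (negbTE nux).
Qed.

Lemma pm_mx_trmx x : x \is a GRing.unit -> pm_mx x *m (pm_mx x)^T = 1%:M.
Proof.
move=> ux; apply/matrixP => j k; rewrite !mxE.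
have [u xu] := r_surj (etrans (unitrMr (r j) ux) (r_unit j)).
under eq_bigr do rewrite !mxE.
rewrite (sum_eqpm (fun v => (eqpm (r v) (x * r k))%:R) xu); congr (nat_of_bool _)%:R.
rewrite -eqpm_r; apply/idP/idP => [h|h].
  by apply: (eqpm_mulI ux); apply: eqpm_trans h.
by apply: eqpm_trans (eqpm_mul x h); rewrite eqpm_sym.
Qed.

(** A permutation matrix is orthogonal. At [x = 4] this makes the product of the values [chi 4] its
    own inverse. *)
Lemma det_pm_mx_sqr x : x \is a GRing.unit -> \det (pm_mx x) ^+ 2 = 1.
Proof. by move=> ux; rewrite expr2 -{2}det_tr -det_mulmx pm_mx_trmx // det1. Qed.

Lemma pm_mxX x N : pm_mx x ^+ N = pm_mx (x ^+ N).
Proof.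
elim: N => [|N IH]; first by rewrite !expr0 pm_mx1.
by rewrite !exprS IH -pm_mxM.
Qed.

Lemma codiagonalizable_pm_mx :
  exists2 P, P \in unitmx & forall x, is_diag_mx (P *m pm_mx x *m invmx P).
Proof.
have [|P uP /allP dP] := (codiagonalizableP [seq pm_mx x | x <- enum A]).1.
  split=> [_ _ /mapP[x _ ->] /mapP[y _ ->]|_ /mapP[x _ ->]].
    by rewrite /comm_mx !pm_mxM mulrC.
  have [ux|nux] := boolP (x \is a GRing.unit); last first.
    by rewrite pm_mx_nonunit //; exact: diagonalizable0.
  have [N N0 xN] := finComUnitRing_unit_order ux.
  by apply: (diagonalizable_root_unity N0); rewrite pm_mxX xN pm_mx1.
exists P => // x; rewrite -conjumx //.
by apply: (dP (pm_mx x)); apply: map_f; rewrite mem_enum.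
Qed.

Definition pm_char (chi : A -> F) :=
  [/\ forall x y, chi (x * y) = chi x * chi y, forall x, chi (- x) = chi x,
      chi 1 = 1 & forall x, x \isn't a GRing.unit -> chi x = 0].

(* The characters are the common eigenvalues of the commuting matrices [pm_mx x]:
   [(chi (r j))_j] is an eigenvector for [chi]. *)
Lemma pm_chars_exist : exists X : 'I_m -> A -> F,
  [/\ forall i, pm_char (X i), injective X,
      forall chi, pm_char chi -> exists i, X i = chi,
      forall f : A -> F, \det (\sum_u f (r u) *: pm_mx (r u)) =
        \prod_i \sum_u f (r u) * X i (r u)
    & forall x, \det (pm_mx x) = \prod_i X i x].
Proof.
have [P uP dP] := codiagonalizable_pm_mx.
pose D x := P *m pm_mx x *m invmx P.
have pmE x : pm_mx x = invmx P *m D x *m P.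
  by rewrite /D !mulmxA mulVmx // mul1mx mulmxKV.
pose X i x := D x i i.
have DE x : D x = diag_mx (\row_i X i x).
  apply/matrixP => i j; rewrite [RHS]mxE [X in X *+ _]mxE; case: eqP => [<- //|/eqP ij].
  by rewrite mulr0n; apply: (is_diag_mxP (dP x)).
have DM x y : D (x * y) = D x *m D y.
  by rewrite /D -pm_mxM !mulmxA mulmxKV.
have detP (B : 'M[F]_m) : \det (invmx P *m B *m P) = \det B.
  by rewrite !det_mulmx mulrAC -det_mulmx mulVmx // det1 mul1r.
have XM i x y : X i (x * y) = X i x * X i y.
  have := congr1 (fun B : 'M[F]_m => B i i) (DM x y).
  by rewrite /= !DE mulmx_diag !mxE eqxx !mulr1n ?mxE.
exists X; split.
- move=> i; split=> [x y|x| |x nux]; first exact: XM.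
  + by rewrite /X /D pm_mxN.
  + by rewrite /X /D pm_mx1 mulmx1 mulmxV // mxE eqxx.
  + by rewrite /X /D pm_mx_nonunit // mulmx0 mul0mx mxE.
(* The character table is invertible, so its columns differ. A row vector [c] killed by it makes the
   combination of the [pm_mx (r u)] vanish, and the row of that combination at the class of [1] is
   [c]. *)
- pose M := \matrix_(u, i) X i (r u).
  have uM : M \in unitmx.
    rewrite unitmxE unitfE; apply/det0P => -[c c0 cM].
    have cX : \sum_u c 0 u *: pm_mx (r u) = 0.
      under eq_bigr do rewrite pmE scalemxAl scalemxAr.
      rewrite -mulmx_suml -mulmx_sumr [X in _ *m X *m _](_ : _ = 0).
        by rewrite mulmx0 mul0mx.
      apply/matrixP => i j; rewrite summxE.
      under eq_bigr do rewrite DE !mxE.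
      have /matrixP/(_ 0 i) := cM; rewrite !mxE => cMi.
      case: (i == j); last by rewrite big1 // => u _; rewrite mulr0n mulr0.
      by rewrite -[RHS]cMi; apply: eq_bigr => u _; rewrite mulr1n !mxE.
    have [j0 j0P] := r_surj (unitr1 A).
    case/eqP: c0; apply/matrixP => i k; rewrite ord1 mxE.
    have /matrixP/(_ j0 k) := cX; rewrite summxE mxE => <-.
    rewrite -[LHS](sum_eqpm (fun v => c 0 v) (eqpm_refl (r k))).
    apply: eq_bigr => u _; rewrite !mxE mulrC; congr (_ * (nat_of_bool _)%:R).
    have e := eqpm_mul (r u) j0P; rewrite mulr1 in e.
    apply/idP/idP => h; first by apply: eqpm_trans e; rewrite eqpm_sym.
    by apply: eqpm_trans e _; rewrite eqpm_sym.
  move=> i j Xij; apply/eqP.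
  have : M *m delta_mx i (0 : 'I_1) = M *m delta_mx j 0.
    by rewrite -!colE; apply/matrixP => u z; rewrite !mxE Xij.
  move/(congr1 (mulmx (invmx M))); rewrite !mulKmx // => /matrixP/(_ i 0).
  by rewrite !mxE !eqxx andbT; case: eqP => // _ /eqP; rewrite oner_eq0.
- move=> chi [chiM chiN chi1 chi0].
  have [j0 j0P] := r_surj (unitr1 A).
  pose v : 'cV[F]_m := \col_j chi (r j).
  have eigv x : pm_mx x *m v = chi x *: v.
    have [ux|nux] := boolP (x \is a GRing.unit); last first.
      by rewrite pm_mx_nonunit // mul0mx chi0 // scale0r.
    apply/matrixP => j k; rewrite !mxE -chiM.
    have [u xu] := r_surj (etrans (unitrMr (r j) ux) (r_unit j)).
    rewrite (eqpm_even chiN xu) -(sum_eqpm (fun l => chi (r l)) xu).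
    by apply: eq_bigr => l _; rewrite !mxE.
  (* In the eigenbasis the eigenvector has a nonzero coordinate [i], where the action of [x] is both
     [X i x] and [chi x]. *)
  pose w := P *m v.
  have [i wi] : exists i, w i 0 != 0.
    apply/existsP; rewrite -[X in is_true X]negbK negb_exists; apply/negP => /forallP w0.
    have v0 : v = 0.
      rewrite -(mulKmx uP v) -/w [w](_ : _ = 0) ?mulmx0 //.
      by apply/matrixP => i k; rewrite ord1 [RHS]mxE; apply/eqP; have := w0 i; rewrite negbK.
    have /matrixP/(_ j0 0) := v0; rewrite !mxE -(eqpm_even chiN j0P) chi1.
    by move/eqP; rewrite oner_eq0.
  exists i; apply/funext => x; apply: (mulIf wi).
  have e : D x *m w = chi x *: w.
    by rewrite /D /w mulmxA mulmxKV // -mulmxA eigv scalemxAr.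
  have /matrixP/(_ i 0) := e; by rewrite DE mul_diag_mx mxE [RHS]mxE [X in X * _]mxE.
- move=> f.
  have -> : \sum_u f (r u) *: pm_mx (r u) = invmx P *m (\sum_u f (r u) *: D (r u)) *m P.
    rewrite mulmx_sumr mulmx_suml; apply: eq_bigr => u _.
    by rewrite pmE scalemxAl scalemxAr.
  rewrite detP.
  have -> : \sum_u f (r u) *: D (r u) = diag_mx (\row_i \sum_u f (r u) * X i (r u)).
    apply/matrixP => i j; rewrite summxE !mxE.
    under eq_bigr do rewrite DE !mxE.
    case: (i == j); first by under eq_bigr do rewrite mulr1n.
    by rewrite big1 // => u _; rewrite mulr0n mulr0.
  by rewrite det_diag; apply: eq_bigr => i _; rewrite mxE.
- by move=> x; rewrite pmE detP DE det_diag; apply: eq_bigr => i _; rewrite mxE.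
Qed.

(** Entry [(j, k)] of the weighted sum is [f] at the class of [r k / r j]; moving row [s j], that of
    the inverse, to place [j] turns the quotient into a product. *)
Lemma det_mul_table (s : {perm 'I_m}) (f : A -> F) :
  (forall j, eqpm (r j * r (s j)) 1) -> (forall x, f (- x) = f x) ->
  \det (\matrix_(j, k) f (r j * r k)) =
  (-1) ^+ s * \det (\sum_u f (r u) *: pm_mx (r u)).
Proof.
move=> sP fN.
have -> : \matrix_(j, k) f (r j * r k) =
    row_perm s (\sum_u f (r u) *: pm_mx (r u)).
  apply/matrixP => j k; rewrite !mxE summxE.
  have [u xu] := r_surj (etrans (unitrMr (r k) (r_unit j)) (r_unit k)).
  rewrite (eqpm_even fN xu) -(sum_eqpm (fun u => f (r u)) xu).
  apply: eq_bigr => v _; rewrite !mxE mulrC; congr (_ * (nat_of_bool _)%:R).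
  have e := eqpm_mul (r v) (sP j); rewrite mulr1 mulrCA in e.
  apply/idP/idP => h.
    by apply: (eqpm_mulI (r_unit j)); rewrite eqpm_sym; exact: eqpm_trans e h.
  by rewrite eqpm_sym; exact: eqpm_trans (eqpm_mul (r j) h) e.
by rewrite row_permE det_mulmx det_perm.
Qed.
End SignedRegularRepresentation.

(** An involution is a product of disjoint transpositions, one per pair of moved points; the
    induction strips off one of them. *)
Lemma odd_perm_involution (T : finType) (s : {perm T}) : (s * s)%g = 1%g ->
  ~~ odd #|[set x | s x != x]%SET| /\ s = odd #|[set x | s x != x]%SET|./2 :> bool.
Proof.
move En : #|[set x | s x != x]%SET| => n; elim/ltn_ind: n => n IH in s En *.
move=> ss; have sK x : s (s x) = x by rewrite -permM ss perm1.
have [x /negP xP|sid] := pickP [pred x | s x != x]; last first.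
  have s1 : s = 1%g by apply/permP => x; rewrite perm1; apply/eqP/negPn; rewrite [_ != _]sid.
  move: En; rewrite s1 odd_perm1 (_ : [set x | _]%SET = finset.set0) ?cards0 => [<- //|].
  by apply/setP => x; rewrite !inE perm1 eqxx.
have {xP} xP : s x != x by exact/negP.
pose t := (tperm x (s x) * s)%g.
have tE z : t z = if (z == x) || (z == s x) then z else s z.
  rewrite permM; case: tpermP => [->|->|/eqP zx /eqP zsx].
  - by rewrite eqxx sK.
  - by rewrite eqxx orbT.
  - by rewrite (negbTE zx) (negbTE zsx).
rewrite (_ : s = ~~ t :> bool); last by rewrite odd_permM odd_tperm eq_sym xP addTb negbK.
have moved : [set z | s z != z]%SET = (x |: (s x |: [set z | t z != z]))%SET.
  apply/setP => z; rewrite !inE tE.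
  have [->|zx] := eqVneq z x; first by rewrite xP.
  by have [->|zsx] := eqVneq z (s x); rewrite ?sK //= eq_sym xP.
have nE : n = #|[set z | t z != z]%SET|.+2.
  by rewrite -En moved !cardsU1 !inE !tE !eqxx orbT eq_sym (negbTE xP) eqxx.
have [|||tev ->] := IH #|[set z | t z != z]%SET| _ t; rewrite ?nE /= ?negbK //.
apply/permP => z; rewrite permM perm1 !tE.
have [->|zx] := eqVneq z x; first by rewrite eqxx.
have [->|zsx] := eqVneq z (s x); first by rewrite eqxx orbT.
rewrite /= sK; case: ifP => // /orP[/eqP e|/eqP e].
  by move: zsx; rewrite -e sK eqxx.
by move: zx; rewrite (perm_inj e) eqxx.
Qed.

(** * Units modulo [n] up to sign and the signature of inversion *)

Definition Srep (n : nat) (u : 'I_#|Sset n|) : nat := enum_val u.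

Lemma SrepP n (u : 'I_#|Sset n|) :
  [/\ (0 < Srep u)%N, (2 * Srep u < n)%N & coprime (Srep u) n].
Proof. by have := enum_valP u; rewrite inE => /and3P[]. Qed.

Lemma Srep_inj n : injective (@Srep n).
Proof. by move=> u v /val_inj /enum_val_inj. Qed.

Lemma Srep_surj n a : (0 < a)%N -> (2 * a < n)%N -> coprime a n ->
  exists u : 'I_#|Sset n|, Srep u = a.
Proof.
move=> a0 a2 co; have an : (a < n)%N by lia.
have aS : Ordinal an \in Sset n by rewrite inE /= a0 a2.
by exists (enum_rank_in aS (Ordinal an)); rewrite /Srep enum_rankK_in.
Qed.

(** For odd [n] the reflection [t -> n - t] exchanges the residues below and above [n / 2] without
    fixed point. *)
Lemma sum_Srep (V : nmodType) n (g : nat -> V) : (3 <= n)%N -> odd n ->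
  (forall t, (0 < t < n)%N -> g (n - t)%N = g t) ->
  (forall t, ~~ coprime t n -> g t = 0) ->
  \sum_(t < n) g t = (\sum_u g (@Srep n u)) *+ 2.
Proof.
move=> n3 n_odd g_sym g0.
have -> : \sum_u g (@Srep n u) = \sum_(t < n | (2 * t < n)%N) g t.
  rewrite -(big_enum_val (A := mem (Sset n)) (fun t : 'I_n => g t)) /=.
  rewrite [RHS]big_mkcond [LHS]big_mkcond; apply: eq_bigr => t _; rewrite inE.
  have [co|nco] := boolP (coprime t n); last by rewrite !andbF g0 // if_same.
  by rewrite andbT; case: posnP co => [->|//]; rewrite /coprime gcd0n => /eqP n1; rewrite n1 in n3.
case: n n3 n_odd g_sym g0 => // k n3 n_odd g_sym g0.
(* The residue [0] has no partner in range and is discarded first. *)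
have g00 : g 0%N = 0.
  by apply: g0; rewrite /coprime gcd0n; case: (k) n3 => [|[]].
rewrite big_ord_recl /= g00 add0r [X in X *+ 2]big_mkcond big_ord_recl /= g00 add0r -big_mkcond /=.
rewrite (bigID (fun t : 'I_k => (2 * bump 0 t < k.+1)%N)) /= mulr2n; congr (_ + _).
rewrite [LHS](reindex_inj rev_ord_inj) /=; apply: eq_big => [t|t _].
  by have := ltn_ord t; rewrite /bump /=; move: n_odd => /=; lia.
rewrite /bump /= !add1n -(g_sym t.+1); last by have := ltn_ord t; lia.
by congr g; have := ltn_ord t; lia.
Qed.

Section Representatives.
Variable n : nat.
Hypotheses (n3 : (3 <= n)%N) (n_odd : odd n).

Let n1 : (1 < n)%N. Proof. exact: ltnW. Qed.

Definition Zrep (u : 'I_#|Sset n|) : 'Z_n := (Srep u)%:R.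

Lemma Zp_natr_eq a b : (a%:R == b%:R :> 'Z_n) = (a == b %[mod n]).
Proof. by rewrite -(inj_eq val_inj) /= !val_Zp_nat. Qed.

Lemma Zp_natr_eqN a b : (a%:R == - b%:R :> 'Z_n) = (n %| a + b)%N.
Proof.
by rewrite -subr_eq0 opprK -natrD -[0]/(0%:R) Zp_natr_eq mod0n.
Qed.

Lemma eqpm_natr a b : eqpm (a%:R : 'Z_n) b%:R = (a == b %[mod n]) || (n %| a + b)%N.
Proof. by rewrite /eqpm Zp_natr_eq Zp_natr_eqN. Qed.

Lemma Zrep_unit u : Zrep u \is a GRing.unit.
Proof. by have [_ _ co] := SrepP u; rewrite unitZpE // coprime_sym. Qed.

Lemma Zrep_inj u v : eqpm (Zrep u) (Zrep v) -> u = v.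
Proof.
have [u0 un _] := SrepP u; have [v0 vn _] := SrepP v.
rewrite eqpm_natr !modn_small; [|lia..] => /orP[/eqP/Srep_inj //|/dvdn_leq]; lia.
Qed.

Lemma Zrep_surj x : x \is a GRing.unit -> exists u, eqpm x (Zrep u).
Proof.
rewrite -[x]natr_Zp unitZpE // => co.
have xn : (x < n)%N by rewrite -[X in (_ < X)%N](Zp_cast n1) ltn_ord.
have x0 : (0 < x)%N by case: posnP co => // ->; rewrite /coprime gcdn0; case: (n) n3 => [|[]].
have [x2|x2] := ltnP (2 * x) n.
  have [|u uE] := Srep_surj x0 x2; first by rewrite coprime_sym.
  by exists u; rewrite /Zrep uE eqpm_natr eqxx.
have [|||u uE] := @Srep_surj n (n - x); [lia|lia| |].
  by rewrite coprime_sym -unitZpE // natrB ?(ltnW xn) // pchar_Zp // sub0r unitrN unitZpE.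
by exists u; rewrite /Zrep uE eqpm_natr subnKC ?dvdnn ?orbT // ltnW.
Qed.
End Representatives.

(** * Square roots of [1] and [-1] modulo [n], and the parity of inversion *)

Definition sq1 (n t : nat) : bool := (t * t == 1 %[mod n])%N.
Definition sqN1 (n t : nat) : bool := (n %| (t * t).+1)%N.

(** The Chinese remainder bijection, the source of multiplicativity for the counts of square
    roots. *)
Lemma sum_modn_mul a b (F G : nat -> nat) : (0 < a)%N -> (0 < b)%N -> coprime a b ->
  (\sum_(t < a * b) F (t %% a) * G (t %% b) = (\sum_(t < a) F t) * \sum_(t < b) G t)%N.
Proof.
move=> a0 b0 co.
pose h (t : 'I_(a * b)) : 'I_a * 'I_b :=
  (Ordinal (ltn_pmod t a0), Ordinal (ltn_pmod t b0)).
have h_inj : injective h.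
  move=> s t [sa sb]; apply: val_inj; have := chinese_remainder co s t.
  by rewrite sa sb !eqxx !modn_small // => /eqP.
have h_bij : bijective h.
  by apply: inj_card_bij => //; rewrite card_prod !card_ord.
rewrite big_distrlr /= pair_big /= (reindex h) //.
exact: onW_bij.
Qed.

Lemma coprime_sq1 n t : sq1 n t -> coprime t n.
Proof.
move=> h; have := coprime_modl (t * t) n; rewrite (eqP h) coprime_modl coprime1n.
by rewrite coprimeMl andbb.
Qed.

Lemma coprime_sqN1 n t : sqN1 n t -> coprime t n.
Proof.
move=> /dvdnP[q e]; have : coprime t (t * t).+1 by rewrite -addn1 /coprime gcdnMDl gcdn1.
by rewrite e coprimeMr => /andP[].
Qed.

Lemma sq1_sub n t : (0 < t < n)%N -> sq1 n (n - t) = sq1 n t.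
Proof.
move=> /andP[t0 tn]; rewrite /sq1.
have e : ((n - t) * (n - t) + (2 * t) * n = t * t + n * n)%N by nia.
by rewrite -(modnMDl (2 * t) _ n) addnC e addnC modnMDl.
Qed.

Lemma sqN1_sub n t : (0 < t < n)%N -> sqN1 n (n - t) = sqN1 n t.
Proof.
move=> /andP[t0 tn]; rewrite /sqN1.
have e : (((n - t) * (n - t)).+1 + (2 * t) * n = (t * t).+1 + n * n)%N by nia.
by rewrite -[LHS](dvdn_addl _ (dvdn_mull (2 * t) (dvdnn n))) e dvdn_addl ?dvdn_mull.
Qed.

(** Counts over all residues are multiplicative; counts over representatives give the fixed points
    of inversion. Each of the former is twice the latter. *)
Definition count1 n := (\sum_(t < n) sq1 n t)%N.
Definition countN1 n := (\sum_(t < n) sqN1 n t)%N.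
Definition half1 n := (\sum_u sq1 n (@Srep n u))%N.
Definition halfN1 n := (\sum_u sqN1 n (@Srep n u))%N.

Lemma count1_half n : (3 <= n)%N -> odd n -> count1 n = (half1 n).*2.
Proof.
move=> n3 no; apply: etrans (@sum_Srep nat n (fun t => sq1 n t) n3 no _ _) _.
- by move=> t tn; rewrite sq1_sub.
- by move=> t; apply: contraNeq; rewrite eqb0 negbK; exact: coprime_sq1.
- by rewrite -addnn.
Qed.

Lemma countN1_half n : (3 <= n)%N -> odd n -> countN1 n = (halfN1 n).*2.
Proof.
move=> n3 no; apply: etrans (@sum_Srep nat n (fun t => sqN1 n t) n3 no _ _) _.
- by move=> t tn; rewrite sqN1_sub.
- by move=> t; apply: contraNeq; rewrite eqb0 negbK; exact: coprime_sqN1.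
- by rewrite -addnn.
Qed.

Lemma totient_half n : (3 <= n)%N -> odd n -> totient n = (#|Sset n|).*2.
Proof.
move=> n3 no; rewrite totient_count_coprime big_mkord.
apply: etrans (@sum_Srep nat n (fun t => coprime n t) n3 no _ _) _.
- move=> t /andP[t0 tn]; congr nat_of_bool.
  by rewrite -!unitZpE ?natrB ?pchar_Zp ?sub0r ?unitrN ?(ltnW tn) // (ltnW n3).
- by move=> t; rewrite coprime_sym => /negbTE ->.
- have e : (\sum_u coprime n (@Srep n u) = #|Sset n|)%N.
    rewrite (eq_bigr (fun=> 1%N)) ?sum1_card ?card_ord // => u _.
    by have [_ _ co] := SrepP u; rewrite coprime_sym co.
  by rewrite -[RHS]addnn -[in RHS]e.
Qed.

Lemma count1_mul a b : (0 < a)%N -> (0 < b)%N -> coprime a b ->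
  count1 (a * b) = (count1 a * count1 b)%N.
Proof.
move=> a0 b0 co; rewrite /count1 -(sum_modn_mul (fun t => sq1 a t) (fun t => sq1 b t)) //; apply: eq_bigr => t _.
by rewrite /sq1 chinese_remainder // !modnMml !modnMmr mulnb.
Qed.

Lemma countN1_mul a b : (0 < a)%N -> (0 < b)%N -> coprime a b ->
  countN1 (a * b) = (countN1 a * countN1 b)%N.
Proof.
move=> a0 b0 co; rewrite /countN1 -(sum_modn_mul (fun t => sqN1 a t) (fun t => sqN1 b t)) //; apply: eq_bigr => t _.
have modE d : sqN1 d (t %% d) = sqN1 d t.
  by rewrite /sqN1 /dvdn -[in LHS]addn1 -modnDml modnMm modnDml addn1.
by rewrite !modE mulnb /sqN1 Gauss_dvd.
Qed.

(** The prime [p] cannot divide both [a - b] and [a + b], whose sum is [2 a]; hence one factor takes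
    the whole power. *)
Lemma prime_pow_sqr_inj p e a b : prime p -> odd p -> coprime a p ->
  (b <= a)%N -> (p ^ e %| a * a - b * b)%N -> (p ^ e %| a - b)%N || (p ^ e %| a + b)%N.
Proof.
move=> pp po co ba.
have -> : (a * a - b * b = (a - b) * (a + b))%N by nia.
have [pd|npd] := boolP (p %| a - b)%N; last first.
  rewrite Gauss_dvdr => [->|]; first by rewrite orbT.
  by rewrite coprimeXl // prime_coprime.
rewrite Gauss_dvdl => [->//|]; rewrite coprimeXl // prime_coprime //.
apply/negP => pa; move: co; rewrite coprime_sym prime_coprime // => /negP; apply.
have : (p %| (a - b) + (a + b))%N by rewrite dvdn_add.
have -> : (a - b + (a + b) = 2 * a)%N by lia.
by rewrite Gauss_dvdr // coprimen2.
Qed.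

Lemma half_le1 n (Q : nat -> bool) :
  (forall a b, (0 < b)%N -> (b <= a)%N -> (2 * a < n)%N -> Q a -> Q b -> a = b) ->
  (\sum_u Q (@Srep n u) <= 1)%N.
Proof.
move=> h; case: (pickP (fun u => Q (@Srep n u))) => [u Qu|noQ]; last first.
  by rewrite big1 // => u _; have /= -> := noQ u.
rewrite (bigD1 u) //= Qu big1 // => v vu; apply/eqP; rewrite eqb0; apply: contra vu => Qv.
have [u0 un _] := SrepP u; have [v0 vn _] := SrepP v.
apply/eqP/Srep_inj; have [uv|vu] := leqP (Srep u) (Srep v).
  exact: h.
by symmetry; apply: h => //; exact: ltnW.
Qed.

(** Modulo an odd prime power, [1] has only the square roots [1] and [-1], which form one class. *)
Lemma half1_prime_pow p e : prime p -> odd p -> (0 < e)%N -> half1 (p ^ e) = 1%N.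
Proof.
move=> pp po e0.
have p3 : (3 <= p)%N by have := prime_gt1 pp; case: (p) po => [|[|[|]]].
have n3 : (3 <= p ^ e)%N by apply: leq_trans p3 _; rewrite -{1}(expn1 p) leq_pexp2l // prime_gt0.
apply/eqP; rewrite eqn_leq; apply/andP; split.
  apply: half_le1 => a b b0 ba an Qa Qb.
  have : (p ^ e %| a * a - b * b)%N.
    by rewrite -eqn_mod_dvd ?leq_mul // (eqP Qa) (eqP Qb).
  have co : coprime a p by move/coprime_sq1: Qa; rewrite coprime_pexpr.
  case/(prime_pow_sqr_inj pp po co ba)/orP => /dvdn_leq; lia.
have [|||u u1] := @Srep_surj (p ^ e) 1; [by []|lia|exact: coprime1n|].
by rewrite /half1 (bigD1 u) //= u1 /sq1 muln1 eqxx.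
Qed.

Lemma halfN1_prime_pow p e : prime p -> odd p -> (halfN1 (p ^ e) <= 1)%N.
Proof.
move=> pp po; apply: half_le1 => a b b0 ba an Qa Qb.
have [e0|e0] := posnP e; first by rewrite e0 expn0 in an; lia.
have : (p ^ e %| a * a - b * b)%N.
  have -> : (a * a - b * b = (a * a).+1 - (b * b).+1)%N by lia.
  exact: dvdn_sub.
have co : coprime a p by move/coprime_sqN1: Qa; rewrite coprime_pexpr.
case/(prime_pow_sqr_inj pp po co ba)/orP => /dvdn_leq; lia.
Qed.

(** Inversion fixes the class of [a] exactly when [a ^ 2] is [1] or [-1]. These cases are disjoint,
    since both together would give [n %| 2]. *)
Lemma inverse_perm_parity n (s : {perm 'I_#|Sset n|}) : (3 <= n)%N -> odd n ->
  (forall j, eqpm (Zrep j * Zrep (s j)) (1 : 'Z_n)) ->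
  [/\ (half1 n + halfN1 n <= #|Sset n|)%N,
      ~~ odd (#|Sset n| - (half1 n + halfN1 n)) &
      s = odd (#|Sset n| - (half1 n + halfN1 n))./2 :> bool].
Proof.
move=> n3 no sP; have n1 : (1 < n)%N := ltnW n3.
have r_unit := @Zrep_unit n n3.
have sE j k : (s j == k) = eqpm (Zrep j * Zrep k) 1.
  apply/eqP/idP => [<- //|h]; apply: (Zrep_inj n3 no); apply: (eqpm_mulI (r_unit j)).
  by apply: eqpm_trans (sP j) _; rewrite eqpm_sym.
have ss : (s * s)%g = 1%g.
  apply/permP => j; rewrite permM perm1; apply/eqP; rewrite sE mulrC; exact: sP.
have [ev ->] := odd_perm_involution ss.
have fixE : #|[set u | s u == u]%SET| = (half1 n + halfN1 n)%N.
  rewrite -sum1_card big_mkcond /half1 /halfN1 -big_split; apply: eq_bigr => u _ /=.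
  rewrite inE sE /Zrep -natrM -[1]/(1%:R) eqpm_natr // addn1 -/(sq1 n _) -/(sqN1 n _).
  have [h1|] := boolP (sq1 n (Srep u)); last by case: (sqN1 _ _).
  have [hN|//] := boolP (sqN1 n (Srep u)).
  move: hN; rewrite /sqN1 /dvdn -addn1 -modnDml (eqP h1) modnDml.
  by rewrite modn_small //; lia.
have movE : #|[set u | s u != u]%SET| = (#|Sset n| - (half1 n + halfN1 n))%N.
  rewrite -fixE -[X in (X - _)%N]card_ord -(cardsC [set u | s u == u]%SET) addKn.
  by congr #|pred_of_set _|; apply/setP => u; rewrite !inE.
rewrite -movE; split => //.
by rewrite -fixE -[X in (_ <= X)%N]card_ord max_card.
Qed.

(** The arithmetic trace of the existence of inversion: the parity of the group order determines
    that of the number of fixed classes. *)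
Lemma half_parity n : (3 <= n)%N -> odd n ->
  (half1 n + halfN1 n <= #|Sset n|)%N /\ ~~ odd (#|Sset n| - (half1 n + halfN1 n)).
Proof.
move=> n3 no.
have [s sP] := inverse_perm_exists (Zrep_unit n3) (Zrep_inj n3 no) (Zrep_surj n3 no).
by have [] := inverse_perm_parity n3 no sP.
Qed.

Section CoprimeProduct.
Variables a b : nat.
Hypotheses (a3 : (3 <= a)%N) (ao : odd a) (b3 : (3 <= b)%N) (bo : odd b).
Hypothesis co : coprime a b.

Let ab3 : (3 <= a * b)%N. Proof. nia. Qed.
Let abo : odd (a * b). Proof. by rewrite oddM ao. Qed.

(** The full counts multiply and are twice the halved ones; hence the factor [2] here and in the
    next two lemmas. *)
Lemma card_Sset_mul : #|Sset (a * b)| = (2 * #|Sset a| * #|Sset b|)%N.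
Proof.
have := totient_coprime co; rewrite !totient_half //.
by move: #|Sset (a * b)| #|Sset a| #|Sset b| => x y z; lia.
Qed.

Lemma half1_mul : half1 (a * b) = (2 * half1 a * half1 b)%N.
Proof.
have := count1_mul (ltn_trans _ a3) (ltn_trans _ b3) co; rewrite !count1_half //.
by move=> /(_ isT isT); lia.
Qed.

Lemma halfN1_mul : halfN1 (a * b) = (2 * halfN1 a * halfN1 b)%N.
Proof.
have := countN1_mul (ltn_trans _ a3) (ltn_trans _ b3) co; rewrite !countN1_half //.
by move=> /(_ isT isT); lia.
Qed.
End CoprimeProduct.

(** * Evaluation of the sign [eps_sign] *)

Lemma odd_expn_mod8 p e : odd p -> (p ^ e %% 8)%N = (if odd e then p %% 8 else 1)%N.
Proof.
move=> po; elim: e => [|e IH]; first by rewrite expn0.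
rewrite expnS -modnMmr IH /=; case: (odd e) => /=; last by rewrite muln1.
rewrite -modnMml; have : odd (p %% 8) by lia.
have : (p %% 8 < 8)%N by rewrite ltn_pmod.
by case: (p %% 8)%N => [|[|[|[|[|[|[|[|]]]]]]]].
Qed.

Lemma card_Sset_prime_pow p e : prime p -> odd p -> (0 < e)%N ->
  #|Sset (p ^ e)| = (p./2 * p ^ e.-1)%N.
Proof.
move=> pp po e0.
have p3 : (3 <= p)%N by have := prime_gt1 pp; case: (p) po => [|[|[|]]].
have n3 : (3 <= p ^ e)%N by apply: leq_trans p3 _; rewrite -{1}(expn1 p) leq_pexp2l // prime_gt0.
have := totient_pfactor pp e0; rewrite totient_half ?oddX ?po ?orbT //.
have -> : p.-1 = (p./2).*2 by lia.
by move: #|Sset _| => x; lia.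
Qed.

(** Parity forces [h = 0] for odd [x] and [h = 1] for even [x], so [(x - 1) / 2] or [(x - 2) / 2] is
    to be odd. *)
Lemma odd_half_mod4 x h : (h <= 1)%N -> (1 + h <= x)%N -> ~~ odd (x - (1 + h)) ->
  odd (x - (1 + h))./2 = (x %% 4 == 0)%N || (x %% 4 == 3)%N.
Proof.
rewrite {1 2 3}(divn_eq x 4); have := ltn_pmod x (isT : 0 < 4)%N.
move: (x %/ 4)%N (x %% 4)%N => y r r4.
by case: h => [|[|]] // _; case: r r4 => [|[|[|[|]]]] // _ /=; lia.
Qed.

(** Modulo 2, [h] and [k] are [x + 1] and [y + 1], so [x y - (1 + h k)] is [x + y]; and [4 %| p + q]
    means that [p./2 + q./2] is odd. *)
Lemma odd_half_two_factors p q x y h k : odd p -> odd q ->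
  odd x = odd p./2 -> odd y = odd q./2 -> (h <= 1)%N -> (k <= 1)%N ->
  (1 + h <= x)%N -> ~~ odd (x - (1 + h)) -> (1 + k <= y)%N -> ~~ odd (y - (1 + k)) ->
  (4 %| p + q)%N = odd ((2 * x * y - (2 * 1 * 1 + 2 * h * k))./2).
Proof.
move=> po qo xp yq h1 k1 hx; rewrite oddB // oddD /= => hxo ky; rewrite oddB // oddD /= => kyo.
have -> : (4 %| p + q)%N = odd p./2 (+) odd q./2.
  by move: po qo; clear; lia.
have xy : (1 + h * k <= x * y)%N by move: hx ky; clear; nia.
have -> : (2 * x * y - (2 * 1 * 1 + 2 * h * k) = (x * y - (1 + h * k)).*2)%N.
  by move: xy; clear; lia.
rewrite doubleK oddB // oddD !oddM -xp -yq.
by move: hxo kyo; case: (odd x); case: (odd y); case: (odd h); case: (odd k).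
Qed.

(** For one prime the group order modulo 4 decides, for two primes a parity. With three or more,
    every count carries a factor 4, so half the number of moved classes is even. *)
Lemma eps_sign_half n : (3 <= n)%N -> odd n ->
  eps_sign n = (-1) ^+ odd ((#|Sset n| - (half1 n + halfN1 n))./2).
Proof.
move=> n3 no; have n0 : (0 < n)%N by exact: leq_trans n3.
have := prod_prime_decomp n0; have := @mem_prime_decomp n; rewrite /eps_sign.
have := primes_uniq n; rewrite /primes.
have sgE (b c : bool) : b = c -> (if b then -1 else 1) = (-1) ^+ c :> int.
  by move=> ->; case: c.
have pfact p e : (p, e) \in prime_decomp n -> [/\ prime p, odd p, (0 < e)%N, (3 <= p ^ e)%N & odd (p ^ e)].
  move=> /mem_prime_decomp[pp e0 pe].
  have po : odd p.
    apply: dvdn_odd no; apply: dvdn_trans pe; exact: dvdn_exp.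
  have p3 : (3 <= p)%N by have := prime_gt1 pp; case: (p) po => [|[|[|]]].
  split=> //; last by rewrite oddX po orbT.
  by apply: leq_trans p3 _; rewrite -{1}(expn1 p) leq_pexp2l // prime_gt0.
move: pfact.
case: (prime_decomp n) => [|[p e] [|[q f] rest]] pfact.
- by rewrite big_nil => _ _ n1; rewrite n1 in n3.
- have [pp po e0 pe3 peo] := pfact p e (mem_head _ _).
  rewrite big_seq1 /= => _ _ nE; apply: sgE.
  have [hle hev] := half_parity n3 no; move: hle hev.
  rewrite nE half1_prime_pow // card_Sset_prime_pow //.
  have := halfN1_prime_pow e pp po; move: (halfN1 _) => h.
  move=> h1 hle hev; rewrite odd_half_mod4 // -modnMm.
  have -> : (p ^ e.-1 %% 4 = (p ^ e.-1 %% 8) %% 4)%N.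
    by rewrite modn_dvdm.
  rewrite odd_expn_mod8 //.
  have : [|| p %% 8 == 1, p %% 8 == 3, p %% 8 == 5 | p %% 8 == 7]%N by lia.
  (* Only the parity of [e] matters, both here and for [p ^ e.-1] modulo 8, which leaves a finite
     check on [p %% 8]. *)
  have e4 : ((4 * e + 3) %% 8 = if odd e.-1 then 3 else 7)%N.
    by case: (boolP (odd e.-1)) => oe; lia.
  rewrite [((4 * e + 3) %% 8)%N]e4 => /or4P[] /eqP p8; rewrite p8.
  + have -> : (p./2 %% 4 = 0)%N by lia.
    by rewrite mul0n.
  + have -> : (p./2 %% 4 = 1)%N by lia.
    by case: (odd e.-1).
  + have -> : (p./2 %% 4 = 2)%N by lia.
    by case: (odd e.-1).
  + have -> : (p./2 %% 4 = 3)%N by lia.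
    by case: (odd e.-1).
- have [pp po e0 pe3 peo] := pfact p e (mem_head _ _).
  have [|qp qo f0 qf3 qfo] := pfact q f; first by rewrite !inE eqxx orbT.
  move=> pun pdec nE.
  have pq : coprime (p ^ e) (q ^ f).
    rewrite coprimeXl // coprimeXr // prime_coprime // dvdn_prime2 //.
    by move: pun; rewrite /= inE negb_or => /andP[/andP[]].
  have [rest0|rest0] := eqVneq rest [::].
    move: nE; rewrite rest0 !big_cons big_nil muln1 => nE; apply: sgE.
    rewrite nE card_Sset_mul // half1_mul // halfN1_mul // !half1_prime_pow //.
    have [hp hpe] := half_parity pe3 peo; have [hq hqe] := half_parity qf3 qfo.
    move: hp hpe hq hqe; rewrite !half1_prime_pow //.
    have := halfN1_prime_pow e pp po; have := halfN1_prime_pow f qp qo.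
    have kp : odd #|Sset (p ^ e)| = odd p./2.
      by rewrite card_Sset_prime_pow // oddM oddX po orbT andbT.
    have kq : odd #|Sset (q ^ f)| = odd q./2.
      by rewrite card_Sset_prime_pow // oddM oddX qo orbT andbT.
    move: kp kq; move: #|Sset (p ^ e)| #|Sset (q ^ f)| (halfN1 (p ^ e)) (halfN1 (q ^ f)).
    move=> x y h h'.
    by move=> xp yq h1' h1 hp hpe hq hqe; exact: odd_half_two_factors.
  have cop s r a : prime r -> (forall l g, (l, g) \in s -> prime l /\ r != l) ->
      coprime (r ^ a) (\prod_(l <- s) l.1 ^ l.2)%N.
    move=> pr hs; rewrite big_seq; apply: (big_ind (fun x => coprime (r ^ a) x)) => [|x y cx cy|[l g] /hs[pl rl]].
    - exact: coprimen1.
    - by rewrite coprimeMr cx.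
    - by rewrite coprimeXl // coprimeXr // prime_coprime // dvdn_prime2.
  have primeP l g : (l, g) \in rest -> prime l.
    by move=> lg; have [|//] := pfact l g; rewrite !inE lg !orbT.
  have mem1 l g : (l, g) \in rest -> l \in unzip1 rest by exact: (map_f fst).
  move: pun; rewrite /= inE negb_or => /andP[/andP[_ prest] /andP[qrest _]].
  have cp : coprime (p ^ e) (\prod_(l <- rest) l.1 ^ l.2)%N.
    apply: cop => // l g lg; split; first exact: primeP lg.
    by apply: contraNneq prest => ->; exact: mem1 lg.
  have cq : coprime (q ^ f) (\prod_(l <- rest) l.1 ^ l.2)%N.
    apply: cop => // l g lg; split; first exact: primeP lg.
    by apply: contraNneq qrest => ->; exact: mem1 lg.
  move: nE; rewrite !big_cons /=.
  (* A third prime power divides the remaining cofactor, which is thus at least 3, as the product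
     formulas demand. *)
  have : exists2 l, l \in rest & (3 <= l.1 ^ l.2)%N.
    case: (rest) rest0 pfact => // -[l g] r _ pfact; exists (l, g); first exact: mem_head.
    by have [|//] := pfact l g; rewrite !inE eqxx !orbT.
  case=> l lr l3.
  have : (l.1 ^ l.2 %| \prod_(l <- rest) l.1 ^ l.2)%N by rewrite (big_rem l) //= dvdn_mulr.
  move: cp cq; set c := (\prod_(_ <- _) _)%N => cp cq lc nE.
  have co : odd c by move: no; rewrite nE !oddM => /andP[_ /andP[]].
  have c3 : (3 <= c)%N by apply: leq_trans l3 _; apply: dvdn_leq => //; rewrite odd_gt0.
  have qc3 : (3 <= q ^ f * c)%N by rewrite (leq_trans c3) // leq_pmull // (ltn_trans _ qf3).
  have qco : odd (q ^ f * c) by rewrite oddM qfo.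
  have pqc : coprime (p ^ e) (q ^ f * c) by rewrite coprimeMr pq.
  rewrite nE (card_Sset_mul pe3 peo qc3) // half1_mul // halfN1_mul //.
  rewrite (card_Sset_mul qf3 qfo c3) // half1_mul // halfN1_mul //.
  set d := ((_ - _)./2)%N.
  suff -> : odd d = false by case: (rest) rest0.
  have [x xE] : exists x, d = (x.*2)%N; last by rewrite xE odd_double.
  rewrite /d; move: #|_| #|_| #|_| (half1 _) (half1 _) (half1 _) (halfN1 _) (halfN1 _) (halfN1 _).
  move=> a1 a2 a3 b1 b2 b3 c1 c2 c3'.
  by exists (a1 * a2 * a3 - (b1 * b2 * b3 + c1 * c2 * c3'))%N; clear; lia.
Qed.

(** * The determinant *)

Section Assembly.
Variables (R : realType) (n : nat).
Hypotheses (n3 : (3 <= n)%N) (n_odd : odd n).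

Let n1 : (1 < n)%N. Proof. exact: ltnW. Qed.

Lemma Zp_intr_nat (a : int) : (a%:~R : 'Z_n) = `|(a %% n%:Z)%Z|%N%:R.
Proof.
rewrite [in LHS](divz_eq a n%:Z) rmorphD rmorphM /= [n%:~R]pchar_Zp // mulr0 add0r.
rewrite -[in LHS](@gez0_abs (a %% n%:Z)%Z) ?modz_ge0 //.
by rewrite -lt0n ltnW.
Qed.

Lemma Zp_intr_unit (a : int) : ((a%:~R : 'Z_n) \is a GRing.unit) = coprimez a n%:Z.
Proof.
rewrite Zp_intr_nat unitZpE // coprime_sym /coprimez -gcdz_modl.
by rewrite /gcdz /coprime /= eqz_nat.
Qed.

(** Composition with reduction modulo [n]; it identifies the [pm_char] functions on ['Z_n] with
    [even_chars]. *)
Definition char_of_Zp (X : 'Z_n -> R[i]) (a : int) : R[i] := X a%:~R.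

Lemma char_of_Zp_even (X : 'Z_n -> R[i]) : pm_char X -> @even_chars R n (char_of_Zp X).
Proof.
case=> XM XN X1 X0; rewrite /char_of_Zp; split; last first.
  by rewrite /even_char rmorphN1 XN X1.
split=> [a|a b|a].
- by rewrite rmorphD /= [n%:~R]pchar_Zp // addr0.
- by rewrite rmorphM XM.
rewrite -Zp_intr_unit; have [u|nu] := boolP (_ \is a GRing.unit); last by rewrite X0 ?eqxx.
apply/eqP => h; have := XM a%:~R (a%:~R)^-1; rewrite divrr // X1 h mul0r.
by move/eqP; rewrite oner_eq0.
Qed.

Lemma even_char_of_Zp (chi : int -> R[i]) : @even_chars R n chi ->
  exists2 X : 'Z_n -> R[i], pm_char X & char_of_Zp X = chi.
Proof.
case=> chiD chiE; have [per chiM chi0] := chiD.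
pose X (z : 'Z_n) := chi (z : nat)%:Z.
have XE a : X a%:~R = chi a.
  rewrite /X Zp_intr_nat val_Zp_nat // -(dirichlet_char_modz a chiD).
  rewrite -modz_nat dirichlet_char_modz // gez0_abs ?modz_ge0 //.
  by rewrite -lt0n ltnW.
have lift (z : 'Z_n) : z = (z : nat)%:Z%:~R by rewrite -[LHS]natr_Zp.
exists X; last by apply/funext => a; exact: XE.
split.
- by move=> x y; rewrite (lift x) (lift y) -rmorphM !XE chiM.
- by move=> x; rewrite (lift x) -rmorphN !XE (even_charN chiD).
- rewrite -[1]/(1%:~R) XE; have h : chi 1 != 0 by rewrite chi0 /coprimez gcd1z.
  by apply: (mulfI h); rewrite -chiM !mulr1.
- move=> x; rewrite (lift x) Zp_intr_unit XE -chi0 negbK; exact: eqP.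
Qed.

(** Each even character contributes one factor [chi4 n]; together they form the power of [-1] in the
    determinant. *)
Lemma chi4_odd : chi4 R n%:Z = (-1) ^+ (n./2).
Proof.
rewrite /chi4 modz_nat -signr_odd.
have : (n %% 4 == 1)%N && ~~ odd n./2 || (n %% 4 == 3)%N && odd n./2 by lia.
by case/orP => /andP[/eqP -> h]; rewrite ?h // (negbTE h).
Qed.

Let F (t : nat) : R := sec (2 * t%:R * pi / n%:R).

Let nR : n%:R != 0 :> R. Proof. by rewrite pnatr_eq0; case: (n) n3. Qed.

Let F_mod t : F (t %% n) = F t.
Proof.
rewrite /F /sec [t in RHS](divn_eq t n); congr (_^-1).
rewrite -[LHS](cosDnatM2pi (t %/ n)) natrD natrM; congr cos; by field.
Qed.

Let F_sub t : (t <= n)%N -> F (n - t) = F t.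
Proof.
move=> tn; rewrite /F /sec natrB //; congr (_^-1).
rewrite -[RHS]cosN -[RHS](cosDnatM2pi 1); congr cos; by field.
Qed.

Let f (z : 'Z_n) : R[i] := (F z)%:C.

Let f_natr a : f a%:R = (F a)%:C.
Proof. by rewrite /f val_Zp_nat // F_mod. Qed.

Let fN z : f (- z) = f z.
Proof.
have zn : (z <= n)%N by rewrite ltnW // -[X in (_ < X)%N](Zp_cast n1) ltn_ord.
have -> : - z = (n - z)%:R by rewrite natrB // pchar_Zp // sub0r natr_Zp.
by rewrite f_natr F_sub.
Qed.

(** The L-value formula solved for the secant sum: the sum over all residues is twice the one over
    representatives, and [chi4 n] is its own inverse. *)
Lemma sum_Zrep_even_char (X : 'Z_n -> R[i]) : pm_char X ->
  \sum_u f (Zrep u) * X (Zrep u) =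
  (2 * n%:R / pi)%:C * chi4 R n%:Z * (X 4%:R)^-1 *
    dirichletL 1 (fun a => char_of_Zp X a * chi4 R a).
Proof.
move=> XP; have [chiD chiE] := char_of_Zp_even XP.
have [_ _ chi0] := chiD.
rewrite (dirichletL_even_char n3 n_odd chiD chiE).
set S := LHS.
have -> : \sum_(t < n) char_of_Zp X t%:Z * (F t)%:C = S *+ 2.
  rewrite (@sum_Srep _ n (fun t => char_of_Zp X t%:Z * (F t)%:C)) //.
  - congr (_ *+ 2); apply: eq_bigr => u _; rewrite mulrC; congr (_ * _).
    by rewrite /Zrep f_natr.
  - move=> t /andP[t0 tn]; rewrite F_sub 1?ltnW //; congr (_ * _).
    rewrite /char_of_Zp -[in LHS]subzn 1?ltnW // rmorphB /= [n%:~R]pchar_Zp // sub0r.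
    by have [_ -> _ _] := XP.
  - move=> t nco; suff -> : char_of_Zp X t%:Z = 0 by rewrite mul0r.
    by apply/eqP; rewrite -[_ == _]negbK chi0.
have c4 : chi4 R n%:Z * chi4 R n%:Z = 1.
  by rewrite chi4_odd -expr2 sqrr_sign.
have X4 : char_of_Zp X 4 != 0.
  rewrite chi0 /coprimez /gcdz /= eqz_nat -[_ == _]/(coprime (2 ^ 2) n).
  by rewrite coprime_pexpl // coprime2n.
have -> : (2 * n%:R / pi)%:C = (2 * (pi / (4 * n%:R)))%:C^-1 :> R[i].
  rewrite -fmorphV /=; congr (_%:C).
  have := lt0r_neq0 (pi_gt0 R); move: (pi) => p p0; field.
  by rewrite nR p0.
rewrite -[X 4%:R]/(char_of_Zp X 4).
have p0 : (2 * (pi / (4 * n%:R)))%:C != 0 :> R[i].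
  rewrite -(rmorph0 (real_complex R)) (inj_eq (@complexI _)).
  rewrite lt0r_neq0 // mulr_gt0 // divr_gt0 ?pi_gt0 // mulr_gt0 // ltr0n.
  exact: ltn_trans n3.
have e2 : (2 * (pi / (4 * n%:R)))%:C = 2 * (pi / (4 * n%:R))%:C :> R[i].
  by rewrite rmorphM /= rmorph_nat.
rewrite -[S *+ 2]mulr_natl; move: p0 X4 c4; rewrite e2.
move: ((pi / (4 * n%:R))%:C) (char_of_Zp X 4) (chi4 R n%:Z) => a b c p0 X4 c4.
have a0 : a != 0 by move: p0; rewrite mulf_eq0 negb_or => /andP[].
have -> : (2 * a)^-1 * c * b^-1 * (a * c * b * (2 * S)) = S * (c * c).
  by field; rewrite a0 X4.
by rewrite c4 mulr1.
Qed.

(** The eigenvalue functions [X i] list every even character once, so the product over the set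
    becomes one over indices. *)
Lemma even_chars_enum (G : (int -> R[i]) -> R[i]) (X : 'I_#|Sset n| -> 'Z_n -> R[i]) :
  (forall i, pm_char (X i)) -> injective X ->
  (forall chi, pm_char chi -> exists i, X i = chi) ->
  \big[*%R/1]_(chi \in @even_chars R n) G chi = \prod_i G (char_of_Zp (X i)).
Proof.
move=> XP X_inj X_surj; have char_inj : injective (fun i => char_of_Zp (X i)).
  move=> i j e; apply: X_inj; apply/funext => z; rewrite -[z]natr_Zp.
  exact: (congr1 (fun chi => chi (z : nat)%:Z) e).
rewrite (fsbigE [seq char_of_Zp (X i) | i <- enum 'I_#|Sset n|]).
- rewrite big_map big_enum_cond /= big_mkcond; apply: eq_bigr => i _.
  by rewrite mem_set //; exact: char_of_Zp_even.
- by rewrite map_inj_uniq ?enum_uniq.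
- by move=> chi /= /mapP[i _ ->]; exact: char_of_Zp_even.
- move=> chi /even_char_of_Zp[Y /X_surj[i <-] <-] /mapP[].
  by exists i => //; rewrite mem_enum.
Qed.

Lemma Dmat_complex :
  map_mx (real_complex R) (Dmat R n) = \matrix_(j, k) f (Zrep j * Zrep k).
Proof.
apply/matrixP => j k; rewrite !mxE /Zrep -natrM f_natr /F /Srep.
by rewrite -mulnA [(2 * _)%:R]natrM.
Qed.

Lemma det_Dmat_even_chars :
  (\det (Dmat R n))%:C =
    (eps_sign n)%:~R * (-1) ^+ (((n - 1) * #|Sset n|)./2)%N *
    ((2 * n%:R / pi) ^+ #|Sset n|)%:C *
    \big[*%R/1]_(chi \in @even_chars R n)
       (chi 4 * dirichletL 1 (fun a : int => chi a * chi4 R a)).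
Proof.
have r_unit := Zrep_unit n3; have r_inj := Zrep_inj n3 n_odd.
have r_surj := Zrep_surj n3 n_odd.
have [s sP] := inverse_perm_exists r_unit r_inj r_surj.
have [X [XP X_inj X_surj detX det4]] := pm_chars_exist r_unit r_inj r_surj R[i].
rewrite (even_chars_enum _ XP X_inj X_surj).
have -> : (\det (Dmat R n))%:C = \det (map_mx (real_complex R) (Dmat R n)).
  by rewrite det_map_mx.
rewrite Dmat_complex (det_mul_table r_unit r_inj r_surj sP fN) detX.
under eq_bigr do rewrite sum_Zrep_even_char //.
have -> : (eps_sign n)%:~R = (-1) ^+ s :> R[i].
  have [_ _ ->] := inverse_perm_parity n3 n_odd sP.
  by rewrite eps_sign_half // rmorphXn rmorphN1.
(* The halving is exact because [n - 1] is even. *)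
have -> : (((n - 1) * #|Sset n|)./2 = n./2 * #|Sset n|)%N.
  have -> : (n - 1 = n./2 * 2)%N by lia.
  by rewrite mulnAC muln2 doubleK.
rewrite -[RHS]mulrA -[RHS]mulrA; congr (_ * _).
have X4 : \prod_i char_of_Zp (X i) 4 = \det (pm_mx (@Zrep n) R[i] 4%:R).
  by rewrite det4.
have u4 : (4%:R : 'Z_n) \is a GRing.unit.
  by rewrite unitZpE // -[4%N]/(2 ^ 2)%N coprime_pexpr // coprimen2.
(* The secant sums carry the inverses of the [chi 4] and the goal the [chi 4] themselves; only their
   total products agree, being a sign. *)
have X4V : (\prod_i char_of_Zp (X i) 4)^-1 = \prod_i char_of_Zp (X i) 4.
  have X4_sqr : (\prod_i char_of_Zp (X i) 4) ^+ 2 = 1.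
    by rewrite X4; exact: (det_pm_mx_sqr r_unit r_inj r_surj R[i] u4).
  have X4_neq0 : \prod_i char_of_Zp (X i) 4 != 0.
    by rewrite -sqrf_eq0 X4_sqr oner_eq0.
  by apply: (mulfI X4_neq0); rewrite -expr2 X4_sqr divff.
rewrite exprM -chi4_odd !big_split /= prodfV X4V !prodr_const card_ord rmorphXn /=.
by ring.
Qed.
End Assembly.

Theorem theorem1p3 (R : realType) (n m : nat) (psi : int -> R[i])
    (hn3 : (3 <= n)%N) (hnodd : odd n) (hm : m = (totient n)./2)
    (hpsi : primitive_char 4 psi) :
  (\det (Dmat R n))%:C =
    (eps_sign n)%:~R * (-1) ^+ (((n - 1) * m)./2)%N * ((2 * n%:R / pi) ^+ m)%:C *
    \big[*%R/1]_(chi \in @even_chars R n)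
       (chi 4 * dirichletL 1 (fun a : int => chi a * psi a)).
Proof.
have -> : m = #|Sset n| by rewrite hm totient_half // doubleK.
by rewrite (primitive_char4_unique hpsi) det_Dmat_even_chars.
Qed.
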